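(* Let $G$ be a non-cyclic finite abelian group and let $\mathbb{F}$ be an algebraically closed field whose characteristic does not divide $|G|$. Write $G\cong C_{n_1}\oplus\dots\oplus C_{n_r}$ with $n_r\mid n_{r-1}\mid\dots\mid n_1$ and $n_r>1$, and let $s$ be the integer with $r=2s-1$ or $r=2s$. If $n_{s+1}\neq 2$, then \[\beta_{\mathrm{sep}}(G)<\beta(G).\]
   Context: $C_n$ denotes the cyclic group of order $n$. A $G$-module is a finite dimensional $\mathbb{F}$-vector space $V$ with a linear action of $G$. $\mathcal{O}(V)$ is the coordinate ring of $V$ (a polynomial algebra with its standard grading), and $\mathcal{O}(V)^G=\{f\in\mathcal{O}(V): f(gv)=f(v)\ \forall v\in V, g\in G\}$ is the algebra of invariants. A subset $S\subset\mathcal{O}(V)^G$ is a separating set if whenever $v,w\in V$ satisfy $f(v)=f(w)$ for all $f\in S$, then $h(v)=h(w)$ for all $h\in\mathcal{O}(V)^G$. $\beta(G,V)$ (respectively $\beta_{\mathrm{sep}}(G,V)$) is the minimal positive integer $d$ such that $\mathcal{O}(V)^G$ contains an $\mathbb{F}$-algebra generating set (respectively a separating set) consisting of homogeneous elements of degree at most $d$. $\beta(G)=\sup_V\beta(G,V)$ and $\beta_{\mathrm{sep}}(G)=\sup_V\beta_{\mathrm{sep}}(G,V)$, the suprema being over all $G$-modules $V$. *)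

(* Defs.v *)
From HB Require Import structures.
From mathcomp Require Import all_boot all_order all_algebra all_fingroup.
From mathcomp Require Import all_solvable all_field all_character.
From mathcomp Require Import mpoly.

Set Implicit Arguments.
Unset Strict Implicit.
Unset Printing Implicit Defensive.

Import GRing.Theory.
Local Open Scope ring_scope.

(* A G-module of dimension n is a matrix representation rG, acting on the left
   on the column vectors 'cV[F]_n by v |-> rG g *m v; its coordinate ring is
   {mpoly F[n]}.  Elements of the coordinate ring are identified with functions
   on V, which is harmless over an infinite field. *)
Definition evalv (F : fieldType) (n : nat) (f : {mpoly F[n]}) (v : 'cV[F]_n)
  : F := f.@[fun i => v i 0].

Section Module.
Variables (F : fieldType) (gT : finGroupType) (G : {group gT}) (n : nat).
Variable rG : mx_representation F G n.

Definition invariant (f : {mpoly F[n]}) : Prop :=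
  forall g, g \in G -> forall v : 'cV[F]_n, evalv f (rG g *m v) = evalv f v.

Definition homog_invariants_le (d : nat) (S : {mpoly F[n]} -> Prop) : Prop :=
  forall f, S f -> invariant f /\ exists2 k : nat, (k <= d)%N & f \is k.-homog.

(* h is a polynomial expression, with coefficients in F, in finitely many
   elements of S. *)
Definition in_subalgebra (S : {mpoly F[n]} -> Prop) (h : {mpoly F[n]}) : Prop :=
  exists (m : nat) (t : m.-tuple {mpoly F[n]}) (Q : {mpoly F[m]}),
    (forall i, S (tnth t i)) /\ h = Q \mPo t.

Definition generating_set (S : {mpoly F[n]} -> Prop) : Prop :=
  (forall f, S f -> invariant f) /\
  (forall h, invariant h -> in_subalgebra S h).

Definition separating_set (S : {mpoly F[n]} -> Prop) : Prop :=
  (forall f, S f -> invariant f) /\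
  (forall v w : 'cV[F]_n, (forall f, S f -> evalv f v = evalv f w) ->
     forall h, invariant h -> evalv h v = evalv h w).

Definition least_positive (P : nat -> Prop) (d : nat) : Prop :=
  [/\ (0 < d)%N, P d & forall e, (0 < e)%N -> P e -> (d <= e)%N].

Definition is_beta (d : nat) : Prop :=
  least_positive
    (fun e => exists2 S, homog_invariants_le e S & generating_set S) d.

Definition is_beta_sep (d : nat) : Prop :=
  least_positive
    (fun e => exists2 S, homog_invariants_le e S & separating_set S) d.

End Module.

Section Group.
Variables (F : fieldType) (gT : finGroupType) (G : {group gT}).

(* b is the (finite) supremum, over all G-modules V over F, of the value
   attached to V by the functional relation B.  The first clause also asks that
   B be defined at every V, so that no module is left out of the supremum. *)
Definition is_sup_modules
    (B : forall n : nat, mx_representation F G n -> nat -> Prop) (b : nat) :=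
  (forall n (rG : mx_representation F G n), exists2 d, B n rG d & (d <= b)%N) /\
  (forall c : nat,
     (forall n (rG : mx_representation F G n) d, B n rG d -> (d <= c)%N) ->
     (b <= c)%N).

Definition is_group_beta (b : nat) : Prop :=
  is_sup_modules (fun n (rG : mx_representation F G n) => is_beta rG) b.

Definition is_group_beta_sep (b : nat) : Prop :=
  is_sup_modules (fun n (rG : mx_representation F G n) => is_beta_sep rG) b.

End Group.

(* G is the direct sum of cyclic groups of orders ns_0, ns_1, ..., stated
   through an internal direct product of cyclic subgroups. *)
Definition cyclic_decomposition (gT : finGroupType) (G : {group gT})
    (ns : seq nat) : Prop :=
  exists2 b : seq gT,
    (\big[dprod/1]_(x <- b) <[x]>)%g = G :> {set gT} & map order b = ns.

(* Main.v *)
Require Import Defs.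
From Stdlib Require Import Classical_Prop.
From HB Require Import structures.
From mathcomp Require Import all_boot all_order all_algebra all_fingroup.
From mathcomp Require Import all_solvable all_field all_character.
From mathcomp Require Import mpoly.
From mathcomp Require Import zify.

(* Diagonalising the action and writing the characters of G as vectors over
   Z/n_1 turns invariant monomials into relations sum_i m_i a_i = 0 between
   elements a_i of a copy of C_(n_1) + ... + C_(n_r), and the theorem into a
   statement on lattices L of relations. Put d = sum_i (n_i - 1).

   On one side, x_1^(n_1 - 1) ... x_r^(n_r - 1) x_(r+1), with the dual basis and
   its sum as characters, has no invariant proper factor, so beta(G) > d.

   On the other side beta_sep(G) <= d as soon as L is spanned by nonnegative
   vectors of length at most d. One climbs the filtration of L by its subgroups
   of vectors divisible by n_1, ..., n_(s+1), 1. A vector c in L is replaced by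
   the short nonnegative vectors of L congruent to c and to - c modulo n_j: take
   the residues in [0, n_j) and correct them by n_j z, where z is short by the
   Klopsch-Lev bound (every element of an abelian group with invariants m_j is a
   nonnegative combination of length at most sum_j (m_j - 1) of any given
   generators). By a Helly type argument c may be assumed to have few nonzero
   coordinates, so that the two lengths add up to at most 2 d + 1, and one of
   the two vectors has length at most d. *)

Set Implicit Arguments.
Unset Strict Implicit.
Unset Printing Implicit Defensive.

Import Order.TTheory GRing.Theory Num.Theory.
Local Open Scope ring_scope.

(** * Nonnegative combinations of generators *)

Section LinearCombinations.
Variables (I : finType) (U : zmodType).
Implicit Types (g : I -> U) (x y c d : {ffun I -> int}) (z : {ffun I -> nat}).

Definition lc g x : U := \sum_i g i *~ x i.

Definition posf z : {ffun I -> int} := [ffun i => (z i)%:Z].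

Definition scalef (k : int) x : {ffun I -> int} := [ffun i => k * x i].

Definition deltaf (j : I) : {ffun I -> int} := [ffun i => (i == j)%:Z].

Lemma lcB g x y : lc g (x - y) = lc g x - lc g y.
Proof. by rewrite /lc -sumrB; apply: eq_bigr => i _; rewrite !ffunE mulrzBr. Qed.

Lemma lcD g x y : lc g (x + y) = lc g x + lc g y.
Proof. by rewrite /lc -big_split; apply: eq_bigr => i _; rewrite !ffunE mulrzDr. Qed.

Lemma lcN g x : lc g (- x) = - lc g x.
Proof. by rewrite /lc -sumrN; apply: eq_bigr => i _; rewrite !ffunE mulrNz. Qed.

Lemma lc_scale g k x : lc g (scalef k x) = lc g x *~ k.
Proof.
by rewrite /lc mulrz_suml; apply: eq_bigr => i _; rewrite ffunE mulrC mulrzA.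
Qed.

Lemma lc_Mn g n x : lc (fun i => g i *+ n) x = lc g x *+ n.
Proof. by rewrite /lc -sumrMnl; apply: eq_bigr => i _; rewrite !pmulrn -!mulrzA mulrC. Qed.

Lemma lc_delta g j : lc g (deltaf j) = g j.
Proof.
rewrite /lc (bigD1 j) //= ffunE eqxx big1 ?addr0 // => i /negPf ij.
by rewrite ffunE ij.
Qed.

Lemma lc_posf g z : lc g (posf z) = \sum_i g i *+ z i.
Proof. by apply: eq_bigr => i _; rewrite ffunE. Qed.

(* For g generating a subgroup H, this says that H / pH is generated by the
   images of at most rho of the g i, for every prime p. *)
Definition rank_le g (rho : nat) : Prop :=
  forall p, prime p -> exists2 T : {set I}, (#|T| <= rho)%N &
    forall x, exists c d, (forall i, i \notin T -> c i = 0) /\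
      lc g x = lc g c + lc g d *+ p.

Lemma rank_leMn g rho n : rank_le g rho -> rank_le (fun i => g i *+ n) rho.
Proof.
move=> rk p /rk[T cT gen]; exists T => // x.
have [c [d [c0 e]]] := gen x; exists c, d; split=> //.
by rewrite !lc_Mn e mulrnDl mulrnAC.
Qed.

Lemma eq_rank_le g g' rho : g =1 g' -> rank_le g rho -> rank_le g' rho.
Proof.
move=> eg rk p /rk[T cT gen]; exists T => // x.
have elc y : lc g' y = lc g y by apply: eq_bigr => i _; rewrite eg.
by have [c [d [c0 e]]] := gen x; exists c, d; split=> //; rewrite !elc.
Qed.

End LinearCombinations.

(* Klopsch-Lev: by induction, dividing all the m j by a prime p that divides
   m (u - 1): modulo p H, the group H generated by g is generated by u of the g i,
   and H' = p H has invariants m j / p. *)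
Lemma short_representation (I : finType) (U : zmodType) (u : nat)
    (m : nat -> nat) (g : I -> U) :
  m u = 1%N -> (0 < m 0%N)%N ->
  (forall i j, (i <= j <= u)%N -> (m j %| m i)%N) ->
  (forall i, g i *+ m 0%N = 0) ->
  (forall j, (j <= u)%N -> rank_le (fun i => g i *+ m j) j) ->
  forall x, exists2 z : {ffun I -> nat}, lc g x = lc g (posf z) &
    (\sum_i z i <= \sum_(j < u) (m j - 1))%N.
Proof.
(* This measure drops both when a trivial invariant is removed and when the invariants are divided
   by a prime. *)
have [k] := ubnP (u + \sum_(j < u) m j)%N.
elim: k u m g => // k IH u m g lek mu m0 dvdm g0 rk x.
have mgt0 j : (j <= u)%N -> (0 < m j)%N.
  by move=> ju; apply: dvdn_gt0 m0 _; apply: dvdm.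
case: u => [|u] in lek mu dvdm rk mgt0 *.
  have gz i : g i = 0 by rewrite -[g i]mulr1n -mu.
  exists [ffun=> 0%N]; last by rewrite big_ord0 big1 // => i _; rewrite ffunE.
  by rewrite /lc !big1 // => i _; rewrite gz mul0rz.
have [mu1|mu1] := eqVneq (m u) 1%N.
  rewrite big_ord_recr /= mu1 subnn addn0; apply: IH => //.
  - by move: lek; rewrite big_ord_recr /=; lia.
  - by move=> i j /andP[ij ju]; apply: dvdm; rewrite ij leqW.
  - by move=> j ju; apply: rk; rewrite leqW.
have p_pr : prime (pdiv (m u)).
  by apply: pdiv_prime; have := mgt0 u (leqnSn u); lia.
set p := pdiv (m u) in p_pr; have p_gt0 := prime_gt0 p_pr.
have pm j : (j <= u)%N -> (p %| m j)%N.
  by move=> ju; apply: dvdn_trans (pdiv_dvd _) _; apply: dvdm; rewrite ju leqnSn.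
pose m' j := if (j <= u)%N then (m j %/ p)%N else 1%N.
have m'p j : (j <= u)%N -> (m' j * p = m j)%N.
  by move=> ju; rewrite /m' ju divnK // pm.
(* As [m u.+1 = 1], this concerns [g] itself: up to a multiple of [p], the element is a combination
   [c] of at most u + 1 generators. *)
have := rk _ (leqnn u.+1) p p_pr; case=> T cT /(_ x).
case=> c [d [c0]]; rewrite mu !lc_Mn !mulr1n => ex.
(* The residues [y] in [0, p) are kept as coefficients. The quotient [q] joins [d], and induction
   treats [d + q] for the family [g i *+ p]. *)
pose q : {ffun I -> int} := [ffun i => (c i %/ p)%Z].
pose y : {ffun I -> nat} := [ffun i => `|(c i %% p)%Z|%N].
have ec : c = posf y + scalef p q.
  apply/ffunP=> i; rewrite !ffunE [LHS](divz_eq _ p) addrC mulrC.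
  by rewrite gez0_abs // modz_ge0 //; lia.
have yp i : (y i <= (i \in T) * (p - 1))%N.
  rewrite ffunE; case: (boolP (i \in T)) => iT; last first.
    by rewrite (c0 i iT) mod0z.
  by rewrite mul1n; have := @ltz_pmod (c i) p; have := @modz_ge0 (c i) p; lia.
have [||||||z ez lez] := IH u.+1 m' (fun i => g i *+ p) _ _ _ _ _ _ (d + q).
- move: lek; rewrite ltnS => lek; apply: leq_trans lek.
  rewrite ltn_add2l !big_ord_recr /= -addnS leq_add //.
    by apply: leq_sum => j _; rewrite /m' /= (ltnW (ltn_ord j)) leq_div.
  by rewrite /m' leqnn ltn_Pdiv ?prime_gt1 ?mgt0.
- by rewrite /m' ltnn.
- by rewrite /m' divn_gt0 // dvdn_leq // pm.
- move=> i j /andP[ij]; rewrite leq_eqVlt => /orP[/eqP->|ju].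
    by rewrite /m' ltnn dvd1n.
  by rewrite -(@dvdn_pmul2r p) // !m'p ?(leq_trans ij) // dvdm // ij leqW.
- by move=> i; rewrite -mulrnA mulnC m'p.
- move=> j; rewrite leq_eqVlt => /orP[/eqP->|ju].
    apply: rank_leMn; apply: rank_leMn.
    by apply: eq_rank_le (rk u.+1 (leqnn _)) => i; rewrite mu.
  apply: eq_rank_le (rk j (leqW ju)) => i.
  by rewrite -mulrnA mulnC m'p.
exists [ffun i => y i + p * z i]%N.
  have -> : posf [ffun i => (y i + p * z i)%N] = posf y + scalef p (posf z).
    by apply/ffunP => i; rewrite !ffunE PoszD PoszM.
  rewrite ex {1}ec !lcD !lc_scale -!addrA; congr (_ + _).
  by rewrite addrC -!pmulrn -mulrnDl -lcD -!lc_Mn.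
under eq_bigr do rewrite ffunE.
rewrite big_split /= -big_distrr /=.
(* From m j = p m' j: m j - 1 = (p - 1) + p (m' j - 1). The first terms pay for the residues on [T],
   the others for p z. *)
have -> : (\sum_(j < u.+1) (m j - 1) =
  u.+1 * (p - 1) + p * \sum_(j < u.+1) (m' j - 1))%N.
  have <- : (\sum_(j < u.+1) (p - 1) = u.+1 * (p - 1))%N by rewrite sum_nat_const card_ord.
  rewrite big_distrr -big_split /=.
  apply: eq_bigr => -[j /= ju] _; rewrite -(m'p j) //.
  have : (0 < m' j)%N.
    rewrite ltnS in ju.
    by rewrite /m' ju divn_gt0 // dvdn_leq ?pm // mgt0 // ltnW.
  by nia.
apply: leq_add; last by rewrite leq_mul2l lez orbT.
apply: leq_trans (leq_sum _ (fun i _ => yp i)) _.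
rewrite -big_distrl /= leq_mul2r -[X in (X <= _)%N]/(\sum_i _)%N.
by rewrite -big_mkcond sum1_card cT orbT.
Qed.

(** * Lattices of relations *)

Section Relations.
Variables (I : finType) (U : zmodType).
Implicit Types (g : I -> U) (x y c d : {ffun I -> int}).

(** Subgroups of the integer vectors, as predicates. The one used in the end consists of the
    exponent vectors on which two given points agree. *)
Definition closed_subB (Q : {ffun I -> int} -> Prop) : Prop :=
  Q 0 /\ forall x y, Q x -> Q y -> Q (x - y).

Lemma scalef_mulrz k x : scalef k x = x *~ k.
Proof. by apply/ffunP => i; rewrite ffunMzE ffunE mulrC mulrzz. Qed.

Lemma lcMz g k x : lc g (x *~ k) = lc g x *~ k.
Proof. by rewrite -scalef_mulrz lc_scale. Qed.

Lemma lcMn g k x : lc g (x *+ k) = lc g x *+ k.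
Proof. by rewrite !pmulrn lcMz. Qed.

Variable Q : {ffun I -> int} -> Prop.
Hypothesis Qsub : closed_subB Q.

Lemma closed_subN x : Q x -> Q (- x).
Proof. by move=> Qx; rewrite -sub0r; apply: Qsub.2 => //; case: Qsub. Qed.

Lemma closed_subD x y : Q x -> Q y -> Q (x + y).
Proof. by move=> Qx /closed_subN Qy; rewrite -[y]opprK; apply: Qsub.2. Qed.

Lemma closed_subMn x (k : nat) : Q x -> Q (x *+ k).
Proof. by move=> Qx; elim: k => [|k IH]; [case: Qsub | rewrite mulrS; apply: closed_subD]. Qed.

Lemma closed_subMz x (k : int) : Q x -> Q (x *~ k).
Proof. by move=> Qx; case: k => k; [|apply: closed_subN]; apply: closed_subMn. Qed.

Lemma closed_sub_sum (J : finType) (f : J -> {ffun I -> int}) :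
  (forall j, Q (f j)) -> Q (\sum_j f j).
Proof.
move=> Qf; elim/big_ind: _ => //; [by case: Qsub | exact: closed_subD].
Qed.

(** Local-global principle: the integers carrying [x] into [Q] form an ideal. With [e > 1] it also
    contains the gcd of [e] and some [N] coprime to a prime factor of [e], which is a smaller
    multiplier. *)
Lemma closed_sub_local x (e : nat) : (0 < e)%N -> Q (x *+ e) ->
  (forall p, prime p -> exists2 N, coprime p N & Q (x *+ N)) -> Q x.
Proof.
have [k] := ubnP e; elim: k e => // k IH e; rewrite ltnS => ek e0 Qe loc.
have [e1|e1] := eqVneq e 1%N; first by rewrite e1 in Qe.
have p_pr : prime (pdiv e) by apply: pdiv_prime; lia.
have [N cop QN'] := loc _ p_pr.
apply: (IH (gcdn e N)) => //; last 2 first.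
- by rewrite gcdn_gt0 e0.
- have [u v def _] := egcdnP N e0.
  have -> : x *+ gcdn e N = x *+ e *+ u - x *+ N *+ v.
    by rewrite -!mulrnA [(e * u)%N]mulnC [(N * v)%N]mulnC def mulrnDr addrAC subrr add0r.
  by apply: Qsub.2; apply: closed_subMn.
have lege : (gcdn e N <= e)%N by rewrite dvdn_leq // dvdn_gcdl.
apply: leq_trans ek; rewrite ltn_neqAle lege andbT.
apply/eqP => eg; have : (pdiv e %| N)%N.
  by apply: dvdn_trans (pdiv_dvd e) _; rewrite -eg dvdn_gcdr.
by move: cop; rewrite prime_coprime // => /negP.
Qed.

Definition suppf x : {set I} := [set i | x i != 0].

(* Helly's principle for relations (Domokos): over Z_(p) the g i with i in T,
   #|T| <= rho, span all the others, so that the relation lattice is spanned by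
   relations supported on the sets i |: T. *)
Lemma relations_small_support g (e rho : nat) :
  (0 < e)%N -> (forall i, g i *+ e = 0) -> rank_le g rho ->
  (forall x, lc g x = 0 -> (#|suppf x| <= rho.+1)%N -> Q x) ->
  forall x, lc g x = 0 -> Q x.
Proof.
move=> e0 ge rk Qs.
have lce y : lc g y *+ e = 0.
  by rewrite -lc_Mn /lc big1 // => i _; rewrite ge mul0rz.
have lc0 : lc g 0 = 0 by rewrite /lc big1 // => i _; rewrite ffunE.
have sum_delta y : y = \sum_i deltaf i *~ y i.
  apply/ffunP => j; rewrite sum_ffunE (bigD1 j) //= ffunMzE ffunE eqxx mulrzz mul1r.
  by rewrite big1 ?addr0 // => i /negPf ij; rewrite ffunMzE ffunE eq_sym ij /= mul0rz.
(* The global multiplier is [e]: [x *+ e] is a combination of the relations e delta_i, supported on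
   one point each. *)
move=> x xrel; apply: (@closed_sub_local _ e) => // [|p p_pr].
  rewrite [x]sum_delta -sumrMnl; apply: closed_sub_sum => i.
  rewrite pmulrn mulrzAC; apply: closed_subMz; apply: Qs.
    by rewrite lcMz lc_delta; exact: ge.
  apply: (@leq_trans 1%N) => //; rewrite -(cards1 i); apply/subset_leq_card.
  apply/subsetP => j; rewrite !inE ffunMzE ffunE.
  by have [//|ij /=] := eqVneq j i; rewrite mul0rz eqxx.
have [T cT gen] := rk p p_pr.
(* Iterating generation modulo [p] gives generation modulo every power of [p]. *)
have gen_k k y : exists c d, (forall i, i \notin T -> c i = 0) /\
    lc g y = lc g c + lc g d *+ p ^ k.
  elim: k => [|k [c [d [c0 ey]]]].
    exists 0, y; split=> [i _|]; first by rewrite ffunE.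
    by rewrite lc0 add0r expn0.
  have [c' [d' [c0' ed]]] := gen d.
  exists (c + c' *+ (p ^ k)), d'; split=> [i iT|].
    by rewrite ffunE ffunMnE c0 // c0' // mul0rn addr0.
  by rewrite ey ed mulrnDl addrA -mulrnA -expnS lcD lcMn.
(* The part of [e] prime to [p]: it kills the error term of [gen_k], a multiple of the [p]-part of
   [e], so [g i *+ q] lies in the span of [T]. *)
pose q := (e`_p^')%N.
exists q; first by rewrite coprime_sym (p'nat_coprime (part_pnat _ _)) // pnat_id.
have genq i : exists c, (forall i, i \notin T -> c i = 0) /\ g i *+ q = lc g c.
  have [c [d [c0 ei]]] := gen_k (logn p e) (deltaf i).
  exists (c *+ q); split=> [j jT|]; first by rewrite ffunMnE c0 // mul0rn.
  rewrite lcMn -(lc_delta g i) ei mulrnDl -mulrnA -p_part.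
  by rewrite partnC // lce addr0.
have [C /all_and2[C0 gC]] := fin_all_exists genq.
pose y i := deltaf i *+ q - C i.
have yrel i : lc g (y i) = 0.
  by rewrite /y lcB -gC lcMn lc_delta subrr.
have Qy i : Q (y i).
  apply: Qs => //; apply: (@leq_trans #|i |: T|); last by rewrite cardsU1; case: (_ \notin _); lia.
  apply/subset_leq_card/subsetP => j; rewrite !inE.
  have [//|ij /=] := eqVneq j i; apply: contraNT => jT.
  by rewrite !ffunE ffunMnE ffunE (negPf ij) C0 // mul0rn subr0.
(* Each [y i] with i outside [T] clears coordinate i, so what remains of [x *+ q] is supported on
   [T]. *)
have Qw : Q (x *+ q - \sum_i y i *~ x i).
  apply: Qs.
    rewrite lcB lcMn xrel mul0rn sub0r.
    apply/eqP; rewrite oppr_eq0; apply/eqP.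
    elim/big_ind: _ => [|a b ea eb|i _]; first exact: lc0.
      by rewrite lcD ea eb addr0.
    by rewrite lcMz yrel mul0rz.
  apply: (@leq_trans #|T|); last exact: leqW.
  apply/subset_leq_card/subsetP => j; rewrite inE; apply: contraNT => jT.
  rewrite !ffunE ffunMnE sum_ffunE (bigD1 j) //= big1 ?addr0.
    by rewrite ffunMzE !ffunE ffunMnE ffunE eqxx C0 // subr0 mulrzz mulrnAl mul1r subrr.
  by move=> i /negPf ij; rewrite ffunMzE !ffunE ffunMnE ffunE eq_sym ij C0 // mul0rn subr0 mul0rz.
have -> : x *+ q = (x *+ q - \sum_i y i *~ x i) + \sum_i y i *~ x i by rewrite subrK.
by apply: closed_subD => //; apply: closed_sub_sum => i; apply: closed_subMz.
Qed.
End Relations.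

(** * Climbing the filtration of the relation lattice by divisibility *)

Section Chain.
Variables (I : finType) (U : zmodType) (g : I -> U) (n : nat -> nat) (r d : nat).
Hypotheses (nr : n r = 1%N) (n0 : (0 < n 0%N)%N).
Hypothesis dvd_n : forall i j, (i <= j <= r)%N -> (n j %| n i)%N.
Hypothesis g_n0 : forall i, g i *+ n 0%N = 0.
Hypothesis rk : forall j, (j <= r)%N -> rank_le (fun i => g i *+ n j) j.
Variable Q : {ffun I -> int} -> Prop.
Hypothesis Qsub : closed_subB Q.
Hypothesis Qshort : forall z : {ffun I -> nat},
  lc g (posf z) = 0 -> (\sum_i z i <= d)%N -> Q (posf z).

Let n_gt0 j : (j <= r)%N -> (0 < n j)%N.
Proof. by move=> jr; apply: dvdn_gt0 n0 _; apply: dvd_n. Qed.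

(** Split [x] into its residues and n_j q. The n_j g_i satisfy the rank conditions for the
    invariants n_l / n_j with l < j, so the Klopsch-Lev bound replaces q by a nonnegative vector of
    length at most the sum of the n_l / n_j - 1; the factor n_j turns this into the sum of the n_l -
    n_j. *)
Lemma short_congruent (j : nat) (x : {ffun I -> int}) : (j <= r)%N -> lc g x = 0 ->
  exists z : {ffun I -> nat}, [/\ lc g (posf z) = 0,
    forall i, (n j %| x i - posf z i)%Z &
    (\sum_i z i <= \sum_i `|(x i %% n j)%Z| + \sum_(l < j) (n l - n j))%N].
Proof.
move=> jr xrel; set a := n j.
have a0 : (0 < a)%N by apply: n_gt0.
pose q : {ffun I -> int} := [ffun i => (x i %/ a)%Z].
pose c : {ffun I -> nat} := [ffun i => `|(x i %% a)%Z|%N].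
have ex : x = posf c + scalef a q.
  apply/ffunP=> i; rewrite !ffunE [LHS](divz_eq _ a) addrC mulrC.
  by rewrite gez0_abs // modz_ge0 //; lia.
pose m l := if (l <= j)%N then (n l %/ a)%N else 1%N.
have ma l : (l <= j)%N -> (m l * a = n l)%N.
  by move=> lj; rewrite /m lj divnK // dvd_n // lj.
have [|||||z ez lez] := @short_representation _ _ j m (fun i => g i *+ a) _ _ _ _ _ q.
- by rewrite /m leqnn divnn a0.
- by rewrite -(@ltn_pmul2r a) // mul0n ma.
- move=> k l /andP[kl lj]; rewrite -(@dvdn_pmul2r a) // !ma ?(leq_trans kl) //.
  by rewrite dvd_n // kl (leq_trans lj).
- by move=> i; rewrite -mulrnA mulnC ma.
- move=> l lj; apply: eq_rank_le (rk (leq_trans lj jr)) => i.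
  by rewrite -mulrnA mulnC ma.
exists [ffun i => (c i + a * z i)%N].
have ez' : posf [ffun i => (c i + a * z i)%N] = posf c + scalef a (posf z).
  by apply/ffunP => i; rewrite !ffunE PoszD PoszM.
split.
- rewrite ez' lcD lc_scale -pmulrn -lc_Mn -ez lc_Mn -xrel ex lcD lc_scale.
  by rewrite -pmulrn.
- move=> i; rewrite ez' {1}ex !ffunE opprD addrACA subrr add0r -mulrBr.
  exact: dvdz_mulr.
under eq_bigr do rewrite ffunE.
rewrite big_split /=; apply: leq_add.
  by under eq_bigr do rewrite ffunE.
rewrite -big_distrr /=; apply: (@leq_trans (a * \sum_(l < j) (m l - 1))).
  by rewrite leq_mul2l lez orbT.
rewrite big_distrr; apply: leq_sum => l _ /=.
by rewrite mulnBr muln1 mulnC ma // ltnW.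
Qed.

(* The reflection x |-> - x: of the short representatives of x and of - x modulo
   n j, whose lengths add up to at most 2 d + 1, one is a short relation. *)
Lemma relations_step (j k : nat) : (j <= k <= r)%N ->
  (k.+1 * n j + 2 * \sum_(l < j) (n l - n j) <= (2 * d).+1)%N ->
  (forall x, lc g x = 0 -> (forall i, (n j %| x i)%Z) -> Q x) ->
  forall x, lc g x = 0 -> (forall i, (n k %| x i)%Z) -> Q x.
Proof.
move=> /andP[jk kr] bound Qj x xrel xk; have jr := leq_trans jk kr.
(* A short representative [z] lies in [Q] by [Qshort], and y - z, being divisible by n_j, lies in
   [Q] by the previous level. *)
have reduce y : lc g y = 0 -> (\sum_i `|(y i %% n j)%Z| + \sum_(l < j) (n l - n j) <= d)%N -> Q y.
  move=> yrel small; have [z [zrel zy lez]] := short_congruent jr yrel.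
  have Qz := Qshort zrel (leq_trans lez small).
  rewrite -[y](subrK (posf z)); apply: closed_subD => //; apply: Qj.
    by rewrite lcB yrel zrel subr0.
  by move=> i; have := zy i; rewrite !ffunE.
pose x' : {ffun I -> int} := [ffun i => (x i %/ n k)%Z].
have exx' : x = x' *+ n k.
  by apply/ffunP=> i; rewrite ffunMnE ffunE -mulr_natr natz divzK.
rewrite exx'.
pose Q' y := Q (y *+ n k).
have Q'sub : closed_subB Q'.
  split=> [|y z Qy Qz]; first by rewrite /Q' mul0rn; case: Qsub.
  by rewrite /Q' mulrnBl; apply: Qsub.2.
(* The family n_k g_i has rank at most k, so Helly's principle leaves only vectors with at most k +
   1 nonzero coordinates. *)
apply: (@relations_small_support _ _ Q' Q'sub (fun i => g i *+ n k) (n 0%N) k) => //.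
- by move=> i; rewrite mulrnAC g_n0 mul0rn.
- exact: rk.
- move=> y; rewrite lc_Mn => yrel suppy; rewrite /Q'.
  set w := y *+ n k.
  have wrel : lc g w = 0 by rewrite lcMn.
  (* The residues of t and - t modulo n_j add up to 0 or n_j, and to 0 where [y] vanishes. *)
  have sum_le : (\sum_i `|(w i %% n j)%Z| + \sum_i `|((- w) i %% n j)%Z| <= k.+1 * n j)%N.
    apply: leq_trans (_ : #|suppf y| * n j <= _)%N; last by rewrite leq_mul2r suppy orbT.
    rewrite -sum_nat_const [X in (_ <= X)%N]big_mkcond -big_split /=; apply: leq_sum => i _.
    rewrite inE ffunE /w ffunMnE; have [->|yi] := eqVneq (y i) 0.
      by rewrite mul0rn oppr0 mod0z.
    have njne : (n j)%:Z != 0 by have := n_gt0 jr; lia.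
    set t := (y i *+ n k).
    have := modz_ge0 t njne; have := modz_ge0 (- t) njne.
    have nj0 : (0 : int) < n j by have := n_gt0 jr; lia.
    have := ltz_pmod t nj0; have := ltz_pmod (- t) nj0.
    have := divz_eq t (n j); have := divz_eq (- t) (n j).
    move: (t %/ n j)%Z (t %% n j)%Z ((- t) %/ n j)%Z ((- t) %% n j)%Z => q1 a1 q2 a2.
    move=> e2 e1 lt2 lt1 ge2 ge1.
    have e12 : a1 + a2 = (- (q1 + q2)) * n j by lia.
    have lt12 : - (q1 + q2) < 2.
      by rewrite -(ltr_pM2r nj0) -e12; lia.
    have : a1 + a2 <= n j by rewrite e12; move: nj0 lt12; nia.
    by rewrite /=; clear -ge1 ge2; lia.
  (* The two length bounds sum to at most 2 d + 1, so if the one for [w] exceeds [d], the one for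
     [- w] does not. *)
  have [le1|gt1] := leqP (\sum_i `|(w i %% n j)%Z| + \sum_(l < j) (n l - n j)) d.
    exact: reduce.
  rewrite -[w]opprK; apply: closed_subN => //; apply: reduce; first by rewrite lcN wrel oppr0.
  move: bound sum_le gt1.
  move: (\sum_(l < j) _)%N (\sum_i `|(w i %% n j)%Z|)%N (\sum_i `|((- w) i %% n j)%Z|)%N (k.+1 * n j)%N.
  by move=> b a1 a2 c; clear; lia.
- by rewrite lc_Mn -lcMn -exx'.
Qed.

(** Levels 0 to s are climbed one at a time, which only costs that n_0 + ... + n_(s-1) is at most d.
    The last step jumps from s straight to r, and [last_bound] is its reflection inequality. *)
Lemma relations_generated_short (s : nat) : (s <= r)%N ->
  (\sum_(l < s) n l <= d)%N -> (0 < s)%N ->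
  (r.+1 * n s + 2 * \sum_(l < s) (n l - n s) <= (2 * d).+1)%N ->
  forall x, lc g x = 0 -> Q x.
Proof.
move=> sr led s0 last_bound.
have level j : (j <= s)%N ->
    forall x, lc g x = 0 -> (forall i, (n j %| x i)%Z) -> Q x.
  (* Base: a vector divisible by n_0 is a combination of the n_0 delta_i, which are relations of
     length n_0 <= d. *)
  elim: j => [_ x xrel x0|j IH js].
    have -> : x = \sum_i posf [ffun k => ((k == i) * n 0)%N] *~ (x i %/ n 0%N)%Z.
      apply/ffunP => k; rewrite sum_ffunE (bigD1 k) //= ffunMzE !ffunE eqxx mul1n mulrzz.
      rewrite big1 ?addr0 => [|i /negPf ik]; first by rewrite mulrC divzK.
      by rewrite ffunMzE !ffunE eq_sym ik mul0n mul0rz.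
    apply: closed_sub_sum => // i; apply: closed_subMz => //; apply: Qshort.
      rewrite lc_posf big1 // => k _; rewrite ffunE; case: eqP => [->|]; last by rewrite mul0n.
      by rewrite mul1n g_n0.
    under eq_bigr do rewrite ffunE.
    rewrite -big_distrl /= (bigD1 i) //= eqxx big1 => [|k /negPf->//].
    rewrite addn0 mul1n; apply: leq_trans led.
    by case: s s0 {sr last_bound} => // s _; rewrite big_ord_recl leq_addr.
  apply: relations_step (IH (ltnW js)); first by rewrite leqnSn (leq_trans js).
  (* Here k = j + 1, and (j + 2) n_j <= 2 (j + 1) n_j bounds the left side by twice n_0 + ... +
     n_j. *)
  apply: (@leq_trans (2 * d)) => //.
  have jr := leq_trans (ltnW js) sr.
  apply: (@leq_trans (2 * \sum_(l < s) n l)); last by rewrite leq_mul2l led.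
  apply: (@leq_trans (2 * \sum_(l < j.+1) n l)); last first.
    rewrite leq_mul2l /= -(subnKC js) big_split_ord /=.
    exact: leq_addr.
  have -> : (\sum_(l < j.+1) n l = \sum_(l < j) (n l - n j) + j * n j + n j)%N.
    rewrite big_ord_recr /= -[X in (X * n j)%N]card_ord -sum_nat_const -big_split /=.
    congr (_ + _)%N; apply: eq_bigr => l _; rewrite subnK // dvdn_leq //.
      by rewrite n_gt0 // ltnW // (leq_trans (ltn_ord l)).
    by rewrite dvd_n // jr ltnW.
  by have := n_gt0 jr; nia.
move=> x xrel; apply: (@relations_step s r) => //; first by rewrite sr leqnn.
  exact: level.
by move=> i; rewrite nr dvd1z.
Qed.

End Chain.

(** * Ranks of subgroups of a homocyclic group *)

Section RankTorsion.
Variables (I : finType) (U : finZmodType) (g : I -> U) (e rho : nat).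
Hypotheses (e_gt0 : (0 < e)%N) (g_e : forall i, g i *+ e = 0).
Variable D : {set U}.
Hypothesis lc_in_D : forall x, lc g x \in D.
Variable p : nat.
Hypothesis p_pr : prime p.
Hypothesis torsion_le : (#|[set a in D | a *+ p == 0%R]| <= p ^ rho)%N.

(** The subgroup generated by the [g i]. Since [e] kills them, coefficients in [0, e) suffice, which
    presents it as a finite image. *)
Let K : {set U} := [set lc g (posf [ffun i => f i : nat]) | f : {ffun I -> 'I_e}].
Let pK : {set U} := [set a *+ p | a in K].

Let memK x : lc g x \in K.
Proof.
pose f := [ffun i => Ordinal (ltn_pmod `|(x i %% e)%Z| e_gt0)].
apply/imsetP; exists f => //; apply: eq_bigr => i _; rewrite !ffunE /= modn_small.
  rewrite gez0_abs; last by apply: modz_ge0; lia.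
  by rewrite {1}(divz_eq (x i) e) mulrzDr mulrC mulrzA -pmulrn g_e mul0rz add0r.
by have := @ltz_pmod (x i) e; have := @modz_ge0 (x i) e; lia.
Qed.

Let mempK a : reflect (exists y, a = lc g y *+ p) (a \in pK).
Proof.
apply: (iffP imsetP) => [[b /imsetP[f _ ->] ->]|[y ->]]; first by eexists.
by exists (lc g y).
Qed.

(** Multiplication by [p] maps [K] onto [pK]; subtracting the section [s] embeds each fibre into the
    [p]-torsion of [D], as differences of elements of [K] are again combinations. *)
Let cardK : (#|K| <= #|pK| * p ^ rho)%N.
Proof.
pose s b := odflt 0 [pick a in K | a *+ p == b].
pose Kp := [set a in D | a *+ p == 0%R].
apply: (@leq_trans (#|pK| * #|Kp|)); last by rewrite leq_mul2l torsion_le orbT.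
rewrite -cardsX; apply: leq_trans (leq_imset_card (fun u => s u.1 + u.2) _).
apply/subset_leq_card/subsetP => a aK; apply/imsetP.
have : s (a *+ p) \in K /\ s (a *+ p) *+ p = a *+ p.
  rewrite /s; case: pickP => [b /andP[bK /eqP]|/(_ a)] //=; by rewrite aK eqxx.
case=> sK sp; exists (a *+ p, a - s (a *+ p)); last by rewrite addrC subrK.
rewrite in_setX /= inE mulrnBl sp subrr eqxx andbT; apply/andP; split.
  by apply/imsetP; exists a.
by case/imsetP: aK => f _ ea; case/imsetP: sK => h _ ->; rewrite ea -lcB lc_in_D.
Qed.

(** Linear independence over Z/p, in K / pK, of the classes of the [g i] with i in [T]. *)
Let indep (T : {set I}) := [forall c : {ffun I -> 'I_p},
  (\sum_(i in T) g i *+ c i \in pK) ==> [forall i in T, c i == 0 :> nat]].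

Let indepP T (x : {ffun I -> int}) : indep T -> (forall i, i \notin T -> x i = 0) ->
  lc g x \in pK -> forall i, (p %| x i)%Z.
Proof.
move=> /forallP iT x0 /mempK[y ey] i.
have [iT'|/x0->] := boolP (i \in T); last exact: dvdz0.
have p0 := prime_gt0 p_pr.
have pz : p%:Z != 0 by lia.
have xlt k : (`|(x k %% p)%Z| < p)%N.
  by have := @ltz_pmod (x k) p; have := @modz_ge0 (x k) p; lia.
pose c := [ffun k => Ordinal (xlt k)].
have /implyP/(_ _)/forall_inP h := iT c.
suff : `|(x i %% p)%Z|%N == 0%N by rewrite absz_eq0 => /eqP/dvdz_mod0P.
have /(_ _ i iT') : \sum_(i in T) g i *+ c i \in pK -> forall i, i \in T -> c i == 0 :> nat.
  by move=> hm; apply: h.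
rewrite ffunE /=; apply; apply/mempK; exists (y - [ffun k => (x k %/ p)%Z]).
rewrite lcB mulrnBl -ey /lc -sumrMnl -sumrB big_mkcond /=; apply: eq_bigr => k _.
rewrite !ffunE /=; case: ifPn => [kT|/x0->]; last by rewrite div0z !mulr0z mul0rn subr0.
rewrite {2}(divz_eq (x k) p) mulrzDr mulrzA -pmulrn addrAC subrr add0r pmulrn.
by rewrite gez0_abs // modz_ge0.
Qed.

(** An independent [T] gives p^#|T| distinct cosets of [pK] in [K]; compare with [cardK]. *)
Let cardT T : indep T -> (#|T| <= rho)%N.
Proof.
move=> iT; have p0 := prime_gt0 p_pr.
rewrite -(@leq_exp2l p) ?prime_gt1 //.
have pK_gt0 : (0 < #|pK|)%N.
  by apply/card_gt0P; exists (lc g 0 *+ p); apply/mempK; exists 0.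
rewrite -(@leq_pmul2l #|pK|) //; apply: leq_trans cardK.
pose F := [set f in pffun_on (Ordinal p0) T (predT : {pred 'I_p})].
have cF : #|F| = (p ^ #|T|)%N by rewrite cardsE card_pffun_on card_ord.
pose X (f : {ffun I -> 'I_p}) := posf [ffun i => f i : nat].
rewrite -cF -cardsX.
have inj : {in setX pK F &, injective (fun u : U * {ffun I -> 'I_p} => u.1 + lc g (X u.2))}.
  move=> [w f] [w' f'] /setXP[/mempK[y ->] /=]; rewrite inE => /pffun_onP[sf _].
  move=> /setXP[/mempK[y' ->] /=]; rewrite inE => /pffun_onP[sf' _] eq.
  have f0 (h : {ffun I -> 'I_p}) i : (Ordinal p0).-support h \subset T -> i \notin T -> X h i = 0.
    move=> /subsetP sh; apply: contraNeq => h0; apply: sh.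
    rewrite inE; apply: contra h0 => /eqP hi.
    by rewrite !ffunE hi.
  have dvd := @indepP T (X f - X f') iT.
  have ff' : f = f'.
    apply/ffunP => i; apply: val_inj => /=.
    have : (p %| (X f - X f') i)%Z.
      apply: dvd => [k kT|]; first by rewrite !ffunE; have := f0 f k sf kT; have := f0 f' k sf' kT; rewrite !ffunE => -> ->.
      apply/mempK; exists (y' - y); rewrite !lcB mulrnBl.
      by apply/eqP; rewrite subr_eq addrAC -eq addrAC subrr add0r.
    rewrite !ffunE; move: (ltn_ord (f i)) (ltn_ord (f' i)) => l l'.
    by rewrite -eqz_mod_dvd !modz_nat eqz_nat !modn_small // => /eqP.
  by move: eq; rewrite -ff' => /addIr->.
rewrite -(card_in_imset inj); apply/subset_leq_card/subsetP => _ /imsetP[[w f] /setXP[/mempK[y /= ->] _] ->] /=.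
by rewrite -lcMn -lcD memK.
Qed.

(** A maximal independent set is a basis of K / pK, and [cardT] bounds its size. *)
Lemma generators_mod_p : exists2 T : {set I}, (#|T| <= rho)%N &
  forall x, exists c d : {ffun I -> int}, (forall i, i \notin T -> c i = 0) /\
    lc g x = lc g c + lc g d *+ p.
Proof.
have ind0 : indep set0.
  by apply/forallP => c; apply/implyP => _; apply/forall_inP => i; rewrite inE.
have [T /maxsetP[iT maxT] _] := maxset_exists ind0.
exists T; first exact: cardT.
have p0 := prime_gt0 p_pr.
have gen1 j : exists c : {ffun I -> int}, (forall i, i \notin T -> c i = 0) /\
    exists d : {ffun I -> int}, g j = lc g c + lc g d *+ p.
  have [jT|jT] := boolP (j \in T).
    exists (deltaf j); split.
      by move=> i; rewrite ffunE; case: eqP => // ->; rewrite jT.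
    by exists 0; rewrite lc_delta /lc [X in X *+ p]big1 ?mul0rn ?addr0 // => i _; rewrite ffunE.
  have : ~~ indep (j |: T).
    by apply/negP => /maxT -/(_ (subsetUr _ _)) e1; rewrite -e1 setU11 in jT.
  case/forallPn => c; rewrite negb_imply => /andP[/mempK[y cy]] /forall_inPn[i0 i0T ci0].
  rewrite big_setU1 //= in cy.
  pose x := [ffun i => if i \in T then (c i)%:Z else 0].
  have ex : \sum_(i in T) g i *+ c i = lc g x.
    by rewrite big_mkcond; apply: eq_bigr => i _; rewrite ffunE; case: ifP.
  have xT i : i \notin T -> x i = 0 by rewrite ffunE => /negPf->.
  (* The dependence must involve [j], because [T] is independent. *)
  have cj0 : c j != 0 :> nat.
    apply/eqP => cj0; rewrite cj0 mulr0n add0r ex in cy.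
    have pc : forall i, (p %| x i)%Z by apply: (indepP iT xT); apply/mempK; exists y.
    move: i0T ci0; rewrite in_setU1 => /orP[/eqP->|i0T]; first by rewrite cj0.
    have := pc i0; rewrite ffunE i0T -[(p %| _)%Z]/(p %| c i0)%N /dvdn modn_small ?ltn_ord // => /eqP->.
    by [].
  have cj_gt0 : (0 < c j)%N by rewrite lt0n.
  (* Bezout: [u] inverts [c j] modulo [p], so the dependence can be solved for [g j]. *)
  have [u v def _] := egcdnP p cj_gt0.
  have g1 : gcdn (c j) p = 1%N.
    apply/eqP; rewrite -/(coprime _ _) coprime_sym prime_coprime //.
    by rewrite /dvdn modn_small ?ltn_ord.
  rewrite g1 in def.
  exists (- (x *+ u)); split; first by move=> i /xT xi; rewrite ffunE ffunMnE xi mul0rn oppr0.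
  exists (y *+ u - deltaf j *+ v).
  have e1 : g j = g j *+ (u * c j) - g j *+ (v * p).
    by rewrite def mulrnDr addrAC subrr add0r.
  rewrite {1}e1 lcN lcMn lcB !lcMn lc_delta -ex mulrnBl [lc g y *+ u *+ p]mulrnAC -cy.
  rewrite mulrnDl -!mulrnA [(c j * u)%N]mulnC addrA; congr (_ - _).
  by rewrite addrCA addNr addr0.
have [C /all_and2[C0 /fin_all_exists[E gC]]] := fin_all_exists gen1.
move=> x; exists (\sum_j C j *~ x j), (\sum_j E j *~ x j); split.
  move=> i iT'; rewrite sum_ffunE big1 // => j _.
  by rewrite ffunMzE C0 // mul0rz.
have lcs (f : I -> {ffun I -> int}) : lc g (\sum_j f j *~ x j) = \sum_j lc g (f j) *~ x j.
  elim/big_ind2: _ => [|a b a' b' <- <-|j _]; [|by rewrite lcD|by rewrite lcMz].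
  by rewrite /lc big1 // => i _; rewrite ffunE.
rewrite !lcs -sumrMnl -big_split; apply: eq_bigr => j _ /=.
by rewrite {1}gC mulrzDl; congr (_ + _); rewrite !pmulrn mulrzAC.
Qed.

End RankTorsion.

Lemma rank_le_torsion (I : finType) (U : finZmodType) (g : I -> U) (e rho : nat) (D : {set U}) :
  (0 < e)%N -> (forall i, g i *+ e = 0) -> (forall x, lc g x \in D) ->
  (forall p, prime p -> (#|[set a in D | a *+ p == 0%R]| <= p ^ rho)%N) ->
  rank_le g rho.
Proof.
by move=> e0 ge gD tors p p_pr; apply: generators_mod_p e0 ge D gD p p_pr (tors p p_pr).
Qed.

(** If z is killed by p, then N divides the integer z p, and z is recovered from the quotient z p /
    N < p. *)
Lemma card_Zp_torsion (N p : nat) : (1 < N)%N -> (0 < p)%N ->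
  (#|[set z : 'Z_N | z *+ p == 0%R]| <= p)%N.
Proof.
move=> N1 p0; have N0 := ltnW N1.
have dvdP (z : 'Z_N) : z \in [set z : 'Z_N | z *+ p == 0%R] -> (N %| z * p)%N.
  by rewrite inE Zp_mulrn -val_eqE /= {2}(Zp_cast N1) => /eqP/eqP.
pose f (z : 'Z_N) : 'I_p := insubd (Ordinal p0) (z * p %/ N)%N.
have fE z : val (f z) = (z * p %/ N)%N.
  rewrite val_insubd ifT // ltn_divLR // mulnC ltn_pmul2l //.
  by rewrite -[X in (_ < X)%N](Zp_cast N1).
have injf : {in [set z : 'Z_N | z *+ p == 0%R] &, injective f}.
  move=> z z' /dvdP dz /dvdP dz' ff'.
  apply/val_inj/eqP; rewrite -(eqn_pmul2r p0) -(divnK dz) -(divnK dz').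
  by rewrite -!fE ff'.
by rewrite -(card_in_imset injf) -[X in (_ <= X)%N]card_ord max_card.
Qed.

(** n_j annihilates every coordinate l >= j, because n_l divides n_j. Combinations of the
    [a i *+ n j] thus live in j coordinates, each contributing a factor of at most p to the
    p-torsion. *)
Lemma rank_le_exponents (I : finType) (N r : nat) (n : nat -> nat)
    (a : I -> 'rV['Z_N]_r) : (1 < N)%N ->
  (forall i j, (i <= j <= r)%N -> (n j %| n i)%N) ->
  (forall i (l : 'I_r), a i 0 l *+ n l = 0) ->
  forall j, (j <= r)%N -> rank_le (fun i => a i *+ n j) j.
Proof.
move=> N1 dvdn an j jr.
pose D := [set v : 'rV['Z_N]_r | [forall l : 'I_r, (j <= l)%N ==> (v 0%R l == 0%R)]].
have ZN0 (z : 'Z_N) : z *+ N = 0.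
  by rewrite Zp_mulrn; apply: val_inj => /=; rewrite {2}(Zp_cast N1) modnMl.
apply: (@rank_le_torsion _ _ _ N _ D); first exact: ltnW.
- by move=> i; apply/rowP => l; rewrite mulmxnE ZN0 mxE.
- move=> x; rewrite inE; apply/forallP => l; apply/implyP => jl.
  rewrite /lc summxE big1 // => i _.
  have aij : a i 0 l *+ n j = 0.
    have /dvdnP[q ->] : (n l %| n j)%N by apply: dvdn; rewrite jl ltnW.
    by rewrite mulnC mulrnA an mul0rn.
  have E m (v : 'rV['Z_N]_r) : (v *~ m) 0 l = v 0 l *~ m.
    by case: m => m; rewrite ?NegzE ?mulrNz ?mxE -!pmulrn mulmxnE.
  by rewrite E mulmxnE aij mul0rz.
move=> p p_pr; have p0 := prime_gt0 p_pr.
set S := [set v in D | _].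
pose P := [set z : 'Z_N | z *+ p == 0%R].
pose F := pffun_on (0 : 'Z_N) [pred l : 'I_r | (l < j)%N] (mem P).
pose f (v : 'rV['Z_N]_r) := [ffun l => v 0 l].
have injf : injective f by move=> v w /ffunP e; apply/rowP => l; have := e l; rewrite !ffunE.
rewrite -(card_imset _ injf); apply: (@leq_trans #|F|).
  apply/subset_leq_card/subsetP => _ /imsetP[v + ->]; rewrite inE => /andP[+ /eqP vp].
  rewrite inE => /forallP Dv; apply/pffun_onP; split.
    apply/subsetP => l; rewrite !inE ffunE ltnNge; apply: contra => jl.
    exact: implyP (Dv l) jl.
  by move=> z /imageP[l _ ->]; rewrite inE ffunE -mulmxnE vp mxE.
rewrite card_pffun_on; apply: (@leq_trans (p ^ #|[pred l : 'I_r | (l < j)%N]|)).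
  case: #|[pred l : 'I_r | (l < j)%N]| => // k.
  by rewrite leq_exp2r //; apply: card_Zp_torsion.
rewrite leq_exp2l ?prime_gt1 // -sum1_card -(big_ord_widen_cond _ (fun=> true) (fun=> 1%N)) //.
by rewrite sum1_card card_ord.
Qed.

(** * Polynomial functions and diagonalisation *)

(** Makes the Kronecker substitution below injective on monomials with exponents less than [B]. *)
Lemma digits_inj (B n : nat) (m m' : 'I_n -> nat) :
  (forall i, (m i < B)%N) -> (forall i, (m' i < B)%N) ->
  (\sum_(i < n) m i * B ^ i = \sum_(i < n) m' i * B ^ i)%N -> m =1 m'.
Proof.
elim: n m m' => [|n IH] m m' mB m'B; first by move=> _ [].
have shift (f : 'I_n.+1 -> nat) :
    (\sum_(i < n.+1) f i * B ^ i = (\sum_(i < n) f (lift ord0 i) * B ^ i) * B + f ord0)%N.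
  rewrite big_ord_recl muln1 addnC big_distrl; congr (_ + _)%N.
  by apply: eq_bigr => i _; rewrite /= expnSr mulnA.
rewrite !shift => e.
have e0 : m ord0 = m' ord0.
  by have := congr1 (modn^~ B) e; rewrite !modnMDl !modn_small.
have B0 : (0 < B)%N by apply: leq_ltn_trans (mB ord0).
have := IH _ _ (fun i => mB (lift ord0 i)) (fun i => m'B (lift ord0 i)).
have /eqP : ((\sum_(i < n) m (lift ord0 i) * B ^ i) * B = (\sum_(i < n) m' (lift ord0 i) * B ^ i) * B)%N.
  by apply/eqP; rewrite -(eqn_add2r (m ord0)) e e0.
rewrite eqn_pmul2r // => /eqP -> /(_ erefl) eS i.
by have [j ->|->] := unliftP ord0 i.
Qed.

(* Kronecker substitution X_i := X ^ (B ^ i). *)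
Lemma meval_eq0 (F : closedFieldType) (n : nat) (p : {mpoly F[n]}) :
  (forall v : 'I_n -> F, p.@[v] = 0) -> p = 0.
Proof.
move=> p0; pose B := (msize p).+1.
pose k (m : 'X_{1..n}) := (\sum_(i < n) m i * B ^ i)%N.
pose q : {poly F} := \sum_(m <- msupp p) p@_m *: 'X^(k m).
have qa a : q.[a] = 0.
  rewrite -(p0 (fun i => a ^+ (B ^ i))) mevalE horner_sum; apply: eq_bigr => m _.
  rewrite hornerZ hornerXn -prodrXr; congr (_ * _); apply: eq_bigr => i _.
  by rewrite -exprM mulnC.
(* [q + 1] takes the value 1 everywhere, so it has no root and is constant; then [q] is constant
   with value 0. *)
have q0 : q = 0.
  have [s|] := boolP (size (q + 1) == 1%N).
    have : (size q <= 1)%N.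
      rewrite -[q](addrK 1); apply: leq_trans (size_polyD _ _) _.
      by rewrite (eqP s) size_polyN size_poly1.
    move=> sq; have e := size1_polyC sq; have := qa 0; rewrite e hornerC => ->.
    by rewrite polyC0.
  case/closed_rootP => a; rewrite /root hornerD qa hornerC add0r oner_eq0.
  by [].
apply/eqP; rewrite -msupp_eq0; apply: contraT => nz.
case E: (msupp p) nz => [//|m0 s] _.
have m0p : m0 \in msupp p by rewrite E mem_head.
have := congr1 (fun q : {poly F} => q`_(k m0)) q0; rewrite coef_sum coef0.
rewrite (bigD1_seq m0) ?msupp_uniq //= coefZ coefXn eqxx mulr1 big_seq_cond big1 ?addr0.
  by move/eqP; rewrite mcoeff_eq0 m0p.
move=> m /andP[mp mm0]; rewrite coefZ coefXn; case: eqP => [e|]; last by rewrite mulr0.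
have lt (m1 : 'X_{1..n}) i : m1 \in msupp p -> (m1 i < B)%N.
  move=> /msize_mdeg_lt; rewrite mdegE (bigD1 i) //= => lt.
  by rewrite ltnS; apply: leq_trans (ltnW lt); apply: leq_addr.
case/eqP: mm0; apply/mnmP; apply: (@digits_inj B) => //.
- by move=> i; apply: lt.
- by move=> i; apply: lt.
Qed.

Lemma closed_prim_root (F : closedFieldType) (N : nat) : (0 < N)%N ->
  N%:R != 0 :> F -> exists z : F, N.-primitive_root z.
Proof.
move=> N0 Nne0; have := separable_Xn_sub_1 Nne0.
have [rs ers] := closed_field_poly_normal ('X^N - 1 : {poly F}).
have lc1 : lead_coef ('X^N - 1 : {poly F}) = 1 by rewrite lead_coefXnsubC.
rewrite lc1 scale1r in ers; rewrite ers separable_prod_XsubC => urs.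
have /hasP[z _ zp] : has N.-primitive_root rs.
  apply: has_prim_root => //.
    by apply/allP => z; rewrite -root_prod_XsubC -ers -[1]/(1%:P) /root_of_unity.
  have := size_XnsubC (1 : F) N0; rewrite ers size_prod_XsubC => -[->].
  exact: leqnn.
by exists z.
Qed.

(** Each [rG g] is annihilated by X^#|G| - 1, which has distinct roots as #|G| is nonzero in [F];
    commuting diagonalisable matrices are diagonalised together. *)
Lemma repr_diagonalizable (F : closedFieldType) (gT : finGroupType) (G : {group gT})
    (n : nat) (rG : mx_representation F G n) : abelian G -> #|G|%:R != 0 :> F ->
  exists2 P : 'M[F]_n, P \in unitmx & exists chi : gT -> 'rV[F]_n,
    forall g, g \in G -> P *m rG g = diag_mx (chi g) *m P.
Proof.
move=> abG cG.
case: n rG => [|n] rG.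
  by exists 1%:M; [exact: unitmx1 | exists (fun=> 0) => g _; apply/matrixP => -[]].
have [P Pu /allP Pd] : exists2 P : 'M[F]_n.+1, P \in unitmx &
    all [pred A | diagonalizable_for P A] [seq rG g | g in G].
  apply/codiagonalizableP; split.
    move=> _ _ /imageP[g gG ->] /imageP[h hG ->].
    by rewrite /comm_mx -!repr_mxM // (centsP abG).
  move=> _ /imageP[g gG ->]; apply/diagonalizableP.
  have [rs ers] := closed_field_poly_normal ('X^#|G| - 1 : {poly F}).
  have lc1 : lead_coef ('X^#|G| - 1 : {poly F}) = 1 by rewrite lead_coefXnsubC.
  rewrite lc1 scale1r in ers; exists rs.
    by rewrite -separable_prod_XsubC -ers separable_Xn_sub_1.
  rewrite -ers; apply: mxminpoly_min.
  rewrite rmorphB rmorph1 rmorphXn /= horner_mx_X.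
  have -> : rG g ^+ #|G| = rG (g ^+ #|G|)%g.
    elim: #|G| => [|k IH]; first by rewrite repr_mx1.
    by rewrite exprS expgS repr_mxM ?groupX // IH.
  by rewrite expg_cardG // repr_mx1 subrr.
exists P => //; exists (fun g => \row_i (P *m rG g *m invmx P) i i) => g gG.
apply: (canRL (mulmxKV Pu)).
have /(_ _)/(diagonalizable_forP _ Pu) := Pd (rG g) _ => d.
apply/matrixP => i j; rewrite [RHS]mxE; case: eqP => [->|/eqP ij].
  by rewrite mulr1n [RHS]mxE.
by rewrite mulr0n d //; apply/imageP; exists g.
Qed.

Lemma diag_action_character (F : fieldType) (gT : finGroupType) (G : {group gT})
    (k : nat) (rG : mx_representation F G k) (P : 'M[F]_k) (chi : gT -> 'rV[F]_k) :
  P \in unitmx -> (forall g, g \in G -> P *m rG g = diag_mx (chi g) *m P) ->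
  (forall i, chi 1%g 0 i = 1) /\
  (forall i, {in G &, forall g h, chi (g * h)%g 0 i = chi g 0 i * chi h 0 i}).
Proof.
move=> Pu Pchi; split=> [i|i g h gG hG].
  have := Pchi _ (group1 G); rewrite repr_mx1 mulmx1 => /(congr1 (mulmx^~ (invmx P))).
  by rewrite mulmxK // mulmxV // => /matrixP/(_ i i); rewrite !mxE eqxx !mulr1n => <-.
have := Pchi _ (groupM gG hG); rewrite repr_mxM // mulmxA Pchi // -mulmxA Pchi // mulmxA.
move/(congr1 (mulmx^~ (invmx P))); rewrite !mulmxK // mulmx_diag.
by move=> /matrixP/(_ i i); rewrite !mxE eqxx !mulr1n => <-.
Qed.

Lemma mem_bigdprod_cycle (gT : finGroupType) (G : {group gT}) (b : seq gT) :
  (\big[dprod/1]_(x <- b) <[x]>)%g = G :> {set gT} -> forall x, x \in b -> x \in G.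
Proof.
move=> /bigdprodWY defG x xb; rewrite -defG mem_gen //; rewrite big_tnth; apply/bigcupP.
have xlt : (index x b < size b)%N by rewrite index_mem.
exists (Ordinal xlt) => //; rewrite (tnth_nth 1%g) /= nth_index //; exact: cycle_id.
Qed.

(** The characters take values on [b] that are powers of [z], and [a i] lists the exponents for the
    i-th one. Triviality of a product of characters need only be tested on [b], which generates [G];
    there it is a linear condition modulo [N]. *)
Lemma character_exponents (F : fieldType) (gT : finGroupType) (G : {group gT})
    (b : seq gT) (N k : nat) (z : F) (chi : gT -> 'rV[F]_k) :
  (\big[dprod/1]_(x <- b) <[x]>)%g = G :> {set gT} -> (1 < N)%N ->
  N.-primitive_root z -> (forall x, x \in b -> #[x]%g %| N)%N ->
  (forall i, chi 1%g 0 i = 1) ->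
  (forall i, {in G &, forall g h, chi (g * h)%g 0 i = chi g 0 i * chi h 0 i}) ->
  exists a : 'I_k -> 'rV['Z_N]_(size b),
    (forall i l, a i 0 l *+ nth 1%N (map order b) l = 0) /\
    (forall m : 'X_{1..k}, \sum_i a i *+ m i = 0 <->
       forall g, g \in G -> \prod_i chi g 0 i ^+ m i = 1).
Proof.
move=> defG N1 zp bN chi1 chiM.
have ebZ : (Zp_trunc N).+2 = N by apply: Zp_cast.
have genG : G = << \bigcup_(x <- b) <[x]> >>%g :> {set gT} by rewrite (bigdprodWY defG).
have bG := mem_bigdprod_cycle defG.
have chiX i g j : g \in G -> chi (g ^+ j)%g 0 i = chi g 0 i ^+ j.
  move=> gG; elim: j => [|j IH]; first by rewrite chi1.
  by rewrite expgS exprS chiM ?groupX // IH.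
have root x i : x \in b -> chi x 0 i ^+ N = 1.
  move=> xb; have /dvdnP[q ->] := bN x xb.
  by rewrite mulnC exprM -chiX ?bG // expg_order chi1 expr1n.
have zpow i (l : 'I_(size b)) : exists e : 'I_N, chi (nth 1%g b l) 0 i = z ^+ e.
  by have [e ee] := prim_rootP zp (root _ i (mem_nth 1%g (ltn_ord l))); exists e.
have [e ze] : exists e : 'I_k -> 'I_(size b) -> 'I_N,
    forall i (l : 'I_(size b)), chi (nth 1%g b l) 0 i = z ^+ e i l.
  exact: fin_all_exists (fun i => fin_all_exists (zpow i)).
have zZ (t : nat) : z ^+ t = 1 <-> t%:R = 0 :> 'Z_N.
  split=> [/eqP|t0].
    rewrite -(prim_order_dvd zp) => /dvdnP[q ->].
    by apply: val_inj; rewrite /= val_Zp_nat // modnMl.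
  apply/eqP; rewrite -(prim_order_dvd zp) /dvdn.
  by rewrite -val_Zp_nat // t0.
exists (fun i => \row_l (e i l)%:R); split=> [i l|m].
  rewrite mxE -mulrnA; apply/zZ; rewrite exprM -ze.
  rewrite (nth_map 1%g) // -chiX; last by rewrite bG // mem_nth.
  by rewrite expg_order.
have sumE (l : 'I_(size b)) : (\sum_i (\row_l (e i l)%:R : 'rV['Z_N]_(size b)) *+ m i) 0 l =
    (\sum_i e i l * m i)%N%:R.
  rewrite summxE natr_sum; apply: eq_bigr => i _.
  by rewrite mulmxnE mxE natrM mulr_natr.
have prodE (l : 'I_(size b)) :
    \prod_i chi (nth 1%g b l) 0 i ^+ m i = z ^+ (\sum_i e i l * m i)%N.
  by rewrite -prodrXr; apply: eq_bigr => i _; rewrite ze exprM.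
split=> [m0 g gG|m0].
  pose H := [set g in G | \prod_i chi g 0 i ^+ m i == 1].
  have gH : group_set H.
    apply/group_setP; split=> [|x y].
      by rewrite inE group1 big1 //= => i _; rewrite chi1 expr1n.
    rewrite !inE => /andP[xG /eqP x1] /andP[yG /eqP y1]; rewrite groupM //=.
    apply/eqP; rewrite -[RHS]mulr1 -[X in _ = X * _]x1 -[X in _ = _ * X]y1 -big_split /=.
    apply: eq_bigr => i _.
    by rewrite chiM // exprMn.
  suff /subsetP/(_ g gG) : G \subset Group gH by rewrite inE => /andP[_ /eqP].
  rewrite genG gen_subG big_tnth; apply/bigcupsP => l _; rewrite cycle_subG inE.
  rewrite bG ?mem_tnth // (tnth_nth 1%g) /= prodE; apply/eqP/zZ.
  by rewrite -sumE m0 mxE.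
apply/rowP => l; rewrite sumE mxE; apply/zZ; rewrite -prodE; apply: m0.
by rewrite bG // mem_nth.
Qed.

(** * Invariant monomials *)

Section LinearForms.
Variables (F : closedFieldType) (k : nat).
Implicit Types (A P : 'M[F]_k) (v : 'cV[F]_k) (h : {mpoly F[k]}).

(** Composition with these forms is pull-back along [A]. For a diagonalising [P], the ['X_[m] \mPo
    linforms P] are the monomials in eigencoordinates. *)
Definition linforms A : k.-tuple {mpoly F[k]} :=
  [tuple \sum_j A i j *: 'X_j | i < k].

Lemma evalv_comp_linforms A h v : evalv (h \mPo linforms A) v = evalv h (A *m v).
Proof.
rewrite /evalv comp_mpoly_meval; apply: meval_eq => i.
rewrite tnth_mktuple raddf_sum mxE; apply: eq_bigr => j _.
by rewrite /= mevalZ mevalXU.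
Qed.

Lemma evalv_inj h h' : (forall v, evalv h v = evalv h' v) -> h = h'.
Proof.
move=> e; apply/eqP; rewrite -subr_eq0; apply/eqP/meval_eq0 => v.
have := e (\col_i v i); rewrite /evalv mevalB => e'.
rewrite -(meval_eq h (v1 := fun i => (\col_i v i) i 0)); last by move=> i; rewrite mxE.
rewrite -(meval_eq h' (v1 := fun i => (\col_i v i) i 0)); last by move=> i; rewrite mxE.
by rewrite e' subrr.
Qed.

Lemma comp_linformsK P h : P \in unitmx ->
  (h \mPo linforms (invmx P)) \mPo linforms P = h.
Proof.
by move=> Pu; apply: evalv_inj => v; rewrite !evalv_comp_linforms mulKmx.
Qed.

Lemma evalv_monomial A (m : 'X_{1..k}) v :
  evalv ('X_[m] \mPo linforms A) v = \prod_i (A *m v) i 0 ^+ m i.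
Proof. by rewrite evalv_comp_linforms /evalv mevalX. Qed.

Lemma dhomog_monomial A (m : 'X_{1..k}) :
  'X_[m] \mPo linforms A \is (mdeg m).-homog.
Proof.
rewrite comp_mpolyX mdegE.
elim/big_ind2: _ => [|p d q e hp hq|i _]; [exact: dhomog1|exact: dhomogM|].
have h1 : tnth (linforms A) i \is 1.-homog.
  rewrite tnth_mktuple.
  by apply: rpred_sum => j _; apply: dhomogZ; rewrite dhomogX /= mdeg1.
by have := dhomogMn (m i) h1; rewrite mul1n.
Qed.

End LinearForms.

Section Decomposition.
Variables (F : closedFieldType) (gT : finGroupType) (G : {group gT}) (k : nat).
Variables (rG : mx_representation F G k) (P : 'M[F]_k) (chi : gT -> 'rV[F]_k).
Hypothesis Pu : P \in unitmx.
Hypothesis Pchi : forall g, g \in G -> P *m rG g = diag_mx (chi g) *m P.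

Let diag_col (d : 'rV[F]_k) (y : 'cV[F]_k) i : (diag_mx d *m y) i 0 = d 0 i * y i 0.
Proof. by rewrite mul_diag_mx mxE. Qed.

Lemma monomial_invariant (m : 'X_{1..k}) :
  (forall g, g \in G -> \prod_i chi g 0 i ^+ m i = 1) ->
  Defs.invariant rG ('X_[m] \mPo linforms P).
Proof.
move=> chim g gG v; rewrite !evalv_monomial mulmxA Pchi // -mulmxA.
under eq_bigr do rewrite diag_col exprMn.
by rewrite big_split /= chim // mul1r.
Qed.

(** In eigencoordinates g multiplies each monomial by a character value. Comparing the coefficients
    of [h'] and of its translate [hg] leaves only monomials with trivial character. *)
Lemma invariant_decomposition h : Defs.invariant rG h ->
  exists2 h', h = h' \mPo linforms P & forall m, m \in msupp h' ->
    forall g, g \in G -> \prod_i chi g 0 i ^+ m i = 1.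
Proof.
move=> hinv; exists (h \mPo linforms (invmx P)); first by rewrite comp_linformsK.
set h' := _ \mPo _ => m mh g gG.
pose hg := \sum_(m1 <- msupp h') (h'@_m1 * \prod_i chi g 0 i ^+ m1 i) *: 'X_[m1].
have ehg : hg = h'.
  apply: evalv_inj => y.
  have -> : evalv hg y = evalv h' (diag_mx (chi g) *m y).
    rewrite /evalv [in RHS]mevalE raddf_sum; apply: eq_bigr => m1 _ /=.
    rewrite mevalZ mevalX -mulrA -big_split /=; congr (_ * _).
    by apply: eq_bigr => i _; rewrite diag_col exprMn.
  have ey : y = P *m (invmx P *m y) by rewrite mulKVmx.
  rewrite {1}ey mulmxA -Pchi // -mulmxA !evalv_comp_linforms mulKmx //.
  exact: hinv.
have := congr1 (mcoeff m) ehg; rewrite raddf_sum (bigD1_seq m) ?msupp_uniq //=.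
rewrite mcoeffZ mcoeffX eqxx mulr1 [X in _ + X = _ -> _]big1 ?addr0 => [|m1 /negPf m1m]; last first.
  by rewrite /= mcoeffZ mcoeffX m1m mulr0.
by rewrite -[RHS]mulr1 => /mulfI -> //; rewrite -mcoeff_msupp.
Qed.

End Decomposition.

Lemma exists_least (Pr : nat -> Prop) : (exists n, Pr n) ->
  exists2 n, Pr n & forall m, Pr m -> (n <= m)%N.
Proof.
move=> [n0 Pn0]; apply: NNPP => none.
suff {n0 Pn0} : forall n, ~ Pr n by move/(_ n0).
elim/ltn_ind => n IH Pn; apply: none; exists n => // m Pm.
by rewrite leqNgt; apply/negP => /IH.
Qed.

Lemma monomial_chain (k : nat) (m : 'X_{1..k}) :
  exists f : nat -> 'X_{1..k},
    [/\ forall j, (j <= mdeg m)%N -> mdeg (f j) = j, f (mdeg m) = m &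
        forall i j, (i <= j <= mdeg m)%N -> (f i <= f j)%MM].
Proof.
move ed : (mdeg m) => d; elim: d m ed => [|d IH] m ed.
  exists (fun=> m); split=> // j; first by rewrite leqn0 => /eqP->.
  by move=> *; apply: lepm_refl.
have [i mi] : exists i, m i != 0%N.
  apply/existsP; rewrite -negb_forall; apply/negP => /forallP m0.
  by move: ed; rewrite mdegE big1 // => i _; apply/eqP.
have lei : (U_(i) <= m)%MM by rewrite lep1mP.
have [|f [fd fm fle]] := IH (m - U_(i))%MM.
  by have := mdegD (m - U_(i)) U_(i); rewrite submK // ed mdeg1 addn1 => -[].
exists (fun j => if (j <= d)%N then f j else m); split=> [j jd||j l /andP[jl ld]].
- case: leqP => [/fd//|dj]; rewrite ed; apply/eqP; rewrite eqn_leq jd andbT.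
  exact: dj.
- by rewrite ltnn.
have [lled|dl] := leqP l d; first by rewrite (leq_trans jl lled) fle // jl.
case: leqP => [jd|_]; last exact: lepm_refl.
apply: (lepm_trans (m2 := (m - U_(i))%MM)); last exact: lem_subr.
by rewrite -fm fle // jd leqnn.
Qed.

(* Two of the partial sums along a chain of #|U| + 1 monomials coincide. *)
Lemma zero_sum_submonomial (U : finZmodType) (k : nat) (a : 'I_k -> U) (m : 'X_{1..k}) :
  (#|U| <= mdeg m)%N -> exists m1 : 'X_{1..k},
    [/\ (m1 <= m)%MM, (0 < mdeg m1 <= #|U|)%N & \sum_i a i *+ m1 i = 0].
Proof.
move=> Um; have [f [fd fm fle]] := monomial_chain m.
pose w (j : 'I_(#|U|.+1)) := \sum_i a i *+ f j i.
have : ~~ injectiveb w.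
  apply/negP => /injectiveP/leq_card; rewrite card_ord.
  by rewrite ltnn.
case/injectivePn => i [j ij ew].
wlog lt_ij : i j ij ew / (i < j)%N.
  move=> W; have [|lt|e] := ltngtP i j; first exact: W.
    by apply: (W j i); rewrite // eq_sym.
  by case/eqP: ij; apply: val_inj.
have jU : (j <= #|U|)%N by rewrite -ltnS.
have jm := leq_trans jU Um.
have lefij : (f i <= f j)%MM by rewrite fle // ltnW.
exists (f j - f i)%MM; split.
- apply: lepm_trans (lem_subr _ _) _; rewrite -[X in (_ <= X)%MM]fm.
  by rewrite fle // jm leqnn.
- have := mdegD (f j - f i) (f i); rewrite submK // !fd //; last exact: leq_trans (ltnW lt_ij) jm.
  by lia.
apply/eqP; rewrite -(inj_eq (addIr (w i))) add0r [X in _ == X]ew -big_split /=.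
by apply/eqP/eq_bigr => l _; rewrite -mulrnDr -mnmDE submK.
Qed.

(** The largest set admissible for the degree bound [e]. *)
Definition invariants_le (F : fieldType) (gT : finGroupType) (G : {group gT})
    (k : nat) (rG : mx_representation F G k) (e : nat) (f : {mpoly F[k]}) : Prop :=
  Defs.invariant rG f /\ exists2 j : nat, (j <= e)%N & f \is j.-homog.

(** * Invariant monomials as generating and separating sets *)

Section Bounds.
Variables (F : closedFieldType) (gT : finGroupType) (G : {group gT}) (k : nat).
Variables (rG : mx_representation F G k) (P : 'M[F]_k) (chi : gT -> 'rV[F]_k).
Hypothesis Pu : P \in unitmx.
Hypothesis Pchi : forall g, g \in G -> P *m rG g = diag_mx (chi g) *m P.
Variables (U : finZmodType) (a : 'I_k -> U).
Hypothesis aP : forall m : 'X_{1..k}, \sum_i a i *+ m i = 0 <->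
  forall g, g \in G -> \prod_i chi g 0 i ^+ m i = 1.

Lemma invariants_le_monomial e (m : 'X_{1..k}) : \sum_i a i *+ m i = 0 ->
  (mdeg m <= e)%N -> invariants_le rG e ('X_[m] \mPo linforms P).
Proof.
move=> /aP m0 me; split; first exact: monomial_invariant Pchi _ m0.
by exists (mdeg m) => //; apply: dhomog_monomial.
Qed.

(** An invariant monomial of degree above #|U| splits off an invariant factor of degree at most
    #|U|, so induction on the degree applies. This crude bound serves to make beta(G) finite. *)
Lemma generating_invariants_le : generating_set rG (invariants_le rG #|U|).
Proof.
split=> [f []//|h hinv].
pose s := [seq 'X_[bmnm m] \mPo linforms P |
  m : 'X_{1..k < #|U|.+1} <- enum [pred m : 'X_{1..k < #|U|.+1} | \sum_i a i *+ bmnm m i == 0]].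
exists (size s), (in_tuple s).
pose R h := exists Q : {mpoly F[size s]}, h = Q \mPo in_tuple s.
have RM p q : R p -> R q -> R (p * q).
  by move=> [p' ->] [q' ->]; exists (p' * q'); rewrite rmorphM.
suff [Q hQ] : R h.
  exists Q; split=> // i; rewrite (tnth_nth 0) /=.
  have /mapP[m] : s`_i \in s by rewrite mem_nth.
  rewrite mem_enum inE => /eqP m0 ->; apply: invariants_le_monomial => //.
  by rewrite -ltnS bmdeg.
have Rmon (m : 'X_{1..k}) : \sum_i a i *+ m i = 0 -> R ('X_[m] \mPo linforms P).
  have [d] := ubnP (mdeg m); elim: d m => // d IH m; rewrite ltnS => md m0.
  have [mU|Um] := leqP (mdeg m) #|U|.
    have bm : (mdeg m < #|U|.+1)%N by [].
    have ms : 'X_[m] \mPo linforms P \in s.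
      by apply/mapP; exists (BMultinom bm) => //; rewrite mem_enum inE /= m0.
    have lt : (index ('X_[m] \mPo linforms P) s < size s)%N by rewrite index_mem.
    exists 'X_(Ordinal lt); rewrite comp_mpolyXU /= nth_index //.
  have [m1 [le1 /andP[m1_gt0 m1U] m1_0]] := zero_sum_submonomial a (ltnW Um).
  have dm := mdegD (m - m1) m1; rewrite submK // in dm.
  have m2_0 : \sum_i a i *+ (m - m1)%MM i = 0.
    apply/eqP; rewrite -(inj_eq (addIr (\sum_i a i *+ m1 i))) -big_split /= m1_0 addr0.
    apply/eqP; rewrite -[RHS]m0; apply: eq_bigr => i _.
    by rewrite -mulrnDr -mnmDE submK.
  rewrite -(submK le1) mpolyXD rmorphM; apply: RM; apply: IH => //.
    by apply: leq_trans md; rewrite dm -[X in (X < _)%N]addn0 ltn_add2l.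
  by apply: leq_trans (leq_ltn_trans m1U Um) md.
have [h' -> h'0] := invariant_decomposition Pu Pchi hinv.
rewrite comp_mpolyEX big_seq; elim/big_ind: _ => [|p q [p' ->] [q' ->]|m mh].
- by exists 0; rewrite comp_mpoly0.
- by exists (p' + q'); rewrite comp_mpolyD.
have [Q ->] : R ('X_[m] \mPo linforms P) by apply/Rmon/aP/h'0.
by exists (h'@_m *: Q); rewrite comp_mpolyZ.
Qed.

(** Invariants are combinations of invariant monomials in the eigencoordinates y = P v, so it
    suffices to separate by these monomials. *)
Lemma separating_of_monomials d :
  (forall y y' : 'I_k -> F,
    (forall m : 'X_{1..k}, \sum_i a i *+ m i = 0 -> (mdeg m <= d)%N ->
      \prod_i y i ^+ m i = \prod_i y' i ^+ m i) ->
    forall m : 'X_{1..k}, \sum_i a i *+ m i = 0 ->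
      \prod_i y i ^+ m i = \prod_i y' i ^+ m i) ->
  separating_set rG (invariants_le rG d).
Proof.
move=> sep; split=> [f []//|v w vw h hinv].
have [h' -> h'0] := invariant_decomposition Pu Pchi hinv.
rewrite !evalv_comp_linforms /evalv !mevalE !big_seq; apply: eq_bigr => m mh; congr (_ * _).
apply: (sep (fun i => (P *m v) i 0) (fun i => (P *m w) i 0)); last by apply/aP/h'0.
move=> m1 m1_0 m1d; rewrite -!evalv_monomial; apply: vw.
exact: invariants_le_monomial.
Qed.

End Bounds.

(** Where both points have nonzero coordinates, the exponent vectors at which their ratio takes the
    value 1 form a subgroup. It contains the short nonnegative relations, hence all relations. *)
Lemma separating_short (F : fieldType) (N r k : nat) (n : nat -> nat)
    (a : 'I_k -> 'rV['Z_N]_r) (d s : nat) :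
  (1 < N)%N -> n r = 1%N -> (0 < n 0%N)%N ->
  (forall i j, (i <= j <= r)%N -> (n j %| n i)%N) ->
  (forall i (l : 'I_r), a i 0 l *+ n l = 0) ->
  (s <= r)%N -> (0 < s)%N -> (\sum_(l < s) n l <= d)%N ->
  (r.+1 * n s + 2 * \sum_(l < s) (n l - n s) <= (2 * d).+1)%N ->
  forall y y' : 'I_k -> F,
  (forall m : 'X_{1..k}, \sum_i a i *+ m i = 0 -> (mdeg m <= d)%N ->
    \prod_i y i ^+ m i = \prod_i y' i ^+ m i) ->
  forall m : 'X_{1..k}, \sum_i a i *+ m i = 0 ->
    \prod_i y i ^+ m i = \prod_i y' i ^+ m i.
Proof.
move=> N1 nr n0 dvd_n an sr s0 led bound y y' short m m_0.
have rk := rank_le_exponents N1 dvd_n an.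
have a_n0 i : a i *+ n 0%N = 0.
  apply/rowP => l; rewrite mulmxnE mxE.
  have /dvdnP[q ->] : (n l %| n 0%N)%N by apply: dvd_n; rewrite leq0n /= ltnW.
  by rewrite mulnC mulrnA an mul0rn.
have len0 : (n 0%N <= d)%N.
  apply: leq_trans led; case: s s0 {sr bound} => // s _.
  by rewrite big_ord_recl leq_addr.
have pow i : y i ^+ n 0%N = y' i ^+ n 0%N.
  have prodU (u : 'I_k -> F) : \prod_j u j ^+ (U_(i) *+ n 0%N)%MM j = u i ^+ n 0%N.
    rewrite (bigD1 i) //= big1 => [|j /negPf ji].
      by rewrite mulr1 mulmnE mnm1E eqxx mul1n.
    by rewrite mulmnE mnm1E eq_sym ji.
  rewrite -!prodU; apply: short; last by rewrite mdegMn mdeg1 mul1n.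
  rewrite (bigD1 i) //= big1 => [|j /negPf ji].
    by rewrite addr0 mulmnE mnm1E eqxx mul1n.
  by rewrite mulmnE mnm1E eq_sym ji.
(* Equal n_0-th powers force the same vanishing coordinates; a monomial involving one of them is 0
   at both points. *)
have supp i : (y i == 0) = (y' i == 0).
  have := congr1 (fun t => t == 0) (pow i); by rewrite !expf_eq0 n0.
have [/existsP[i /andP[mi yi]]|/existsPn mA] :=
  boolP [exists i, (m i != 0%N) && (y i == 0)].
  have z0 (u : 'I_k -> F) : u i == 0 -> \prod_j u j ^+ m j = 0.
    by move=> ui; apply/eqP; rewrite prodf_seq_eq0; apply/hasP; exists i;
       rewrite ?mem_index_enum //= expf_eq0 lt0n mi.
  by rewrite !z0 // -supp.
(* From here on only nonvanishing coordinates matter, where negative exponents make sense. *)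
pose A : {pred 'I_k} := [pred i | y i != 0].
pose I := {i | i \in A}.
have yA (i : I) : y (val i) != 0 by exact: (valP i).
have y'A (i : I) : y' (val i) != 0 by rewrite -supp yA.
pose Q (x : {ffun I -> int}) := \prod_(i : I) (y (val i) / y' (val i)) ^ x i = 1.
have Qsub : closed_subB Q.
  split=> [|x1 x2 Q1 Q2]; first by rewrite /Q big1 // => i _; rewrite ffunE expr0z.
  rewrite /Q -[RHS](mulfV (oner_neq0 F)) -[X in _ = X / _]Q1 -[X in _ = _ / X]Q2 -prodf_div; apply: eq_bigr => i _.
  have u0 : y (val i) / y' (val i) != 0 by rewrite mulf_neq0 ?invr_neq0.
  by rewrite !ffunE expfzDr // invr_expz.
have prodA (u : 'I_k -> F) (m1 : 'X_{1..k}) : (forall i, i \notin A -> m1 i = 0%N) ->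
    \prod_i u i ^+ m1 i = \prod_(i : I) u (val i) ^+ m1 (val i).
  move=> m1A; rewrite -(big_sub A (fun i => u i ^+ m1 i)) [RHS]big_mkcond.
  by apply: eq_bigr => i _; case: ifPn => // /m1A ->.
have sumA (m1 : 'X_{1..k}) : (forall i, i \notin A -> m1 i = 0%N) ->
    \sum_i a i *+ m1 i = \sum_(i : I) a (val i) *+ m1 (val i).
  move=> m1A; rewrite -(big_sub A (fun i => a i *+ m1 i)) [RHS]big_mkcond.
  by apply: eq_bigr => i _; case: ifPn => // /m1A ->.
have QE (m1 : 'X_{1..k}) : (forall i, i \notin A -> m1 i = 0%N) ->
    Q (posf [ffun i : I => m1 (val i)]) <-> \prod_i y i ^+ m1 i = \prod_i y' i ^+ m1 i.
  move=> m1A; rewrite !prodA // /Q.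
  have -> : \prod_(i : I) (y (val i) / y' (val i)) ^ posf [ffun i : I => m1 (val i)] i =
      \prod_(i : I) y (val i) ^+ m1 (val i) / \prod_(i : I) y' (val i) ^+ m1 (val i).
    by rewrite -prodf_div; apply: eq_bigr => i _; rewrite !ffunE -exprnP expr_div_n.
  have nz : \prod_(i : I) y' (val i) ^+ m1 (val i) != 0.
    by apply/prodf_neq0 => i _; rewrite expf_neq0.
  split=> [/(canRL (divfK nz))|->]; first by rewrite mul1r.
  by rewrite mulfV.
have mA0 i : i \notin A -> m i = 0%N.
  by rewrite inE negbK => yi; have := mA i; rewrite yi andbT negbK => /eqP.
apply/(QE m mA0).
apply: (@relations_generated_short I _ (fun i => a (val i)) n r d) (sr) led s0 bound _ _ => //.
- by move=> j jr; apply: (@rank_le_exponents I N r n).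
- move=> z; rewrite lc_posf => z_0 zd.
  (* Extension of [z] by 0 to the coordinates outside [A]. *)
  pose m1 := [multinom (if insub i is Some j then z j else 0%N) | i < k].
  have m1I (i : I) : m1 (val i) = z i by rewrite mnmE valK.
  have m1A i : i \notin A -> m1 i = 0%N.
    by move=> iA; rewrite mnmE insubN.
  have <- : [ffun i : I => m1 (val i)] = z by apply/ffunP => i; rewrite ffunE m1I.
  apply/QE => //; apply: short.
    by rewrite sumA //; rewrite -[RHS]z_0; apply: eq_bigr => i _; rewrite m1I.
  rewrite mdegE; apply: leq_trans zd.
  rewrite (bigID (mem A)) /= [X in (_ + X)%N]big1 ?addn0; last by move=> i /m1A.
  by rewrite (big_sub A (fun i => m1 i)); apply: leq_sum => i _; rewrite m1I.
by rewrite lc_posf -[RHS]m_0 sumA //; apply: eq_bigr => i _; rewrite ffunE.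
Qed.

(** * The lower bound for the Noether number *)

(** The polynomials with no nonconstant monomial dividing M form a subalgebra: if m1 + m2 = m is
    nonzero and divides M, then so do m1 and m2, and one of them is nonzero. *)
Lemma mcoeff_comp_eq0 (F : fieldType) (k d : nat) (M : 'X_{1..k})
    (t : d.-tuple {mpoly F[k]}) (Q : {mpoly F[d]}) :
  (forall i (m : 'X_{1..k}), (m <= M)%MM -> m != 0%MM -> (tnth t i)@_m = 0) ->
  forall m : 'X_{1..k}, (m <= M)%MM -> m != 0%MM -> (Q \mPo t)@_m = 0.
Proof.
pose Z (p : {mpoly F[k]}) := forall m : 'X_{1..k}, (m <= M)%MM -> m != 0%MM -> p@_m = 0.
move=> tZ; rewrite -/(Z _).
have Z1 : Z 1 by move=> m _ /negPf m0; rewrite mcoeff1 m0.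
have ZM p q : Z p -> Z q -> Z (p * q).
  move=> Zp Zq m mM m0; rewrite mcoeffM big1 // => -[m1 m2] /= /eqP.
  move: (bmnm m1) (bmnm m2) => {m1 m2} m1 m2 em.
  have [e1|m1_0] := eqVneq m1 0%MM; last first.
    by rewrite Zp ?mul0r //; apply: lepm_trans mM; rewrite em lem_addr.
  rewrite [q@_m2]Zq ?mulr0 //; first by apply: lepm_trans mM; rewrite em lem_addl.
  by apply: contraNneq m0 => e2; rewrite em e1 e2 addm0.
rewrite comp_mpolyE; elim/big_ind: _ => [|p q Zp Zq|m' _].
- by move=> m _ _; rewrite mcoeff0.
- by move=> m mM m0; rewrite mcoeffD Zp // Zq // addr0.
suff Zprod : Z (\prod_(i < d) tnth t i ^+ m' i).
  by move=> m mM m0; rewrite mcoeffZ Zprod // mulr0.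
elim/big_ind: _ => // i _; elim: (m' i) => [|j IH]; first by rewrite expr0.
by rewrite exprS; apply: ZM => // m; apply: tZ.
Qed.

Section Coordinates.
Variables (gT : finGroupType) (G : {group gT}) (b : seq gT).
Hypothesis abG : abelian G.
Hypothesis defG : (\big[dprod/1]_(x <- b) <[x]>)%g = G :> {set gT}.
Notation r := (size b).
Notation bb := (fun l : 'I_r => nth 1%g b l).

Let defG' : (\big[dprod/1]_(l < r) <[bb l]>)%g = G :> {set gT}.
Proof. by rewrite -defG (big_nth 1%g) big_mkord. Qed.

Let bG (l : 'I_r) : bb l \in G.
Proof. by apply: (mem_bigdprod_cycle defG); rewrite mem_nth. Qed.

Let expo_uniq (e e' : 'I_r -> nat) :
  (\prod_l bb l ^+ e l)%g = (\prod_l bb l ^+ e' l)%g ->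
  forall l, e l = e' l %[mod #[bb l]%g].
Proof.
move=> ee' l; have eG : (\prod_l bb l ^+ e l)%g \in G.
  by apply: group_prod => j _; rewrite groupX.
have [c [_ _ uniq_c]] := mem_bigdprod defG' eG.
apply/eqP; rewrite -eq_expg_mod_order.
rewrite (uniq_c _ _ (erefl _) l) => [|j _|//]; last exact: mem_cycle.
by rewrite -(uniq_c _ _ ee' l) // => j _; apply: mem_cycle.
Qed.

(** [E g l] is the exponent of the l-th basis element in g. It is determined only modulo the order
    of that element, hence the congruences, which come from uniqueness in the direct product. *)
Lemma dual_coordinates : exists E : gT -> 'I_r -> nat,
  [/\ forall l, #[bb l]%g %| E 1%g l,
      forall l, {in G &, forall g h, E (g * h)%g l = E g l + E h l %[mod #[bb l]%g]} &
      forall l j, E (bb j) l = (l == j) %[mod #[bb l]%g]]%N.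
Proof.
have expo g : exists e : {ffun 'I_r -> nat}, g \in G -> g = (\prod_l bb l ^+ e l)%g.
  have [gG|] := boolP (g \in G); last by exists [ffun=> 0%N].
  have [c [cG -> _]] := mem_bigdprod defG' gG.
  have /fin_all_exists[e ce] l : exists e, c l = (bb l ^+ e)%g by apply/cycleP/cG.
  by exists (finfun e) => _; apply: eq_bigr => l _; rewrite ffunE ce.
have [E EP] := fin_all_exists expo; exists E; split=> [l|l g h gG hG|l j].
- rewrite /dvdn -(mod0n #[bb l]%g); apply/eqP/(expo_uniq (e' := fun=> 0%N)).
  by rewrite -EP // big1 // => j _; rewrite expg0.
- apply: (expo_uniq (e' := fun l => E g l + E h l)%N).
  rewrite -EP ?groupM // {1}(EP g) // {1}(EP h) //.
  elim: (index_enum _) => [|j s IH]; first by rewrite !big_nil mulg1.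
  rewrite !big_cons -IH expgD -!mulgA; congr (_ * _)%g.
  rewrite !mulgA; congr (_ * _)%g.
  apply: (centsP abG); rewrite ?groupX //.
  by apply: group_prod => i _; rewrite groupX.
apply: (expo_uniq (e' := fun l => (l == j))).
rewrite -EP // -[LHS](big_pred1_eq mulg j bb) big_mkcond; apply: eq_bigr => i _ /=.
by case: eqP.
Qed.

End Coordinates.

(* The characters are the dual basis of b and its sum. *)
Lemma large_degree_module (F : closedFieldType) (gT : finGroupType) (G : {group gT})
    (b : seq gT) : abelian G -> (\big[dprod/1]_(x <- b) <[x]>)%g = G :> {set gT} ->
  #|G|%:R != 0 :> F ->
  exists (k : nat) (rG : mx_representation F G k), forall e S,
    homog_invariants_le rG e S -> generating_set rG S ->
    (\sum_(l < size b) (nth 1%N (map order b) l - 1) < e)%N.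
Proof.
move=> abG defG cG; set r := size b.
have [E [E1 EM Eb]] := dual_coordinates abG defG.
pose n (l : 'I_r) := #[nth 1%g b l]%g.
have nE (l : 'I_r) : nth 1%N (map order b) l = n l by rewrite (nth_map 1%g).
have bG (l : 'I_r) : nth 1%g b l \in G.
  by apply: (mem_bigdprod_cycle defG); rewrite mem_nth.
have n_gt0 l : (0 < n l)%N by apply: order_gt0.
have prim l : exists z : F, (n l).-primitive_root z.
  apply: closed_prim_root => //.
  have /dvdnP[q eq] : (n l %| #|G|)%N by apply: order_dvdG.
  by apply: contraNneq cG => n0; rewrite eq natrM n0 mulr0.
have [w wp] := fin_all_exists prim.
(* Variable [lift ord_max l] carries the l-th dual basis character, variable [ord_max] the sum of
   all of them. *)
pose c (i : 'I_r.+1) (l : 'I_r) : nat := if unlift ord_max i is Some j then j == l else 1%N.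
pose chi g : 'rV[F]_r.+1 := \row_i \prod_l w l ^+ (c i l * E g l).
have chi1 i : chi 1%g 0 i = 1.
  rewrite mxE big1 // => l _; apply/eqP; rewrite -(prim_order_dvd (wp l)).
  exact: dvdn_mull (E1 l).
have chiM i : {in G &, forall g h, chi (g * h)%g 0 i = chi g 0 i * chi h 0 i}.
  move=> g h gG hG; rewrite !mxE -big_split /=; apply: eq_bigr => l _.
  rewrite -exprD -mulnDr; apply/eqP; rewrite (eq_prim_root_expr (wp l)).
  by rewrite -modnMmr EM // modnMmr.
have repr : mx_repr G (fun g => diag_mx (chi g)).
  split=> [|g h gG hG]; last first.
    by rewrite mulmx_diag; congr diag_mx; apply/rowP => i; rewrite [RHS]mxE chiM.
  have -> : chi 1%g = const_mx 1 by apply/rowP => i; rewrite chi1 mxE.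
  by rewrite diag_const_mx.
exists r.+1, (MxRepresentation repr) => e S Shom [Sinv gen].
pose M : 'X_{1..r.+1} := [multinom if unlift ord_max i is Some l then (n l - 1)%N else 1%N | i < r.+1].
have M_max : M ord_max = 1%N by rewrite mnmE unlift_none.
have M_lift l : M (lift ord_max l) = (n l - 1)%N by rewrite mnmE liftK.
have sum_lift (f : 'I_r.+1 -> nat) : (\sum_i f i = f ord_max + \sum_l f (lift ord_max l))%N.
  by rewrite (bigD1_ord ord_max).
have mdegM : mdeg M = (\sum_(l < r) (n l - 1)).+1.
  by rewrite mdegE sum_lift M_max add1n; congr _.+1; apply: eq_bigr => l _.
have sum_c (m : 'X_{1..r.+1}) l :
    (\sum_i c i l * m i = m (lift ord_max l) + m ord_max)%N.
  rewrite sum_lift /c unlift_none mul1n addnC; congr (_ + _)%N.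
  rewrite (bigD1 l) //= liftK eqxx mul1n big1 ?addn0 // => j /negPf jl.
  by rewrite liftK jl.
have chi_dvd (m : 'X_{1..r.+1}) : (forall g, g \in G -> \prod_i chi g 0 i ^+ m i = 1) ->
    forall l, (n l %| m (lift ord_max l) + m ord_max)%N.
  move=> m1 l; rewrite (prim_order_dvd (wp l)) -(m1 _ (bG l)).
  have chib i : chi (nth 1%g b l) 0 i = w l ^+ c i l.
    rewrite mxE (bigD1 l) //= big1 => [|j jl].
      rewrite mulr1; apply/eqP; rewrite (eq_prim_root_expr (wp l)) -modnMmr Eb eqxx.
      by rewrite modnMmr muln1.
    apply/eqP; rewrite -(prim_order_dvd (wp j)) /dvdn -modnMmr Eb (negPf jl).
    by rewrite mod0n muln0 mod0n.
  under eq_bigr do rewrite chib -exprM.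
  by rewrite prodrXr sum_c.
(* By [chi_dvd], n_l divides m_l + m_max. If m_max = 0, then m_l <= n_l - 1 forces m = 0; if m_max =
   1, it forces m_l = n_l - 1. *)
have dvd_M (m : 'X_{1..r.+1}) : (m <= M)%MM -> m != 0%MM ->
    (forall g, g \in G -> \prod_i chi g 0 i ^+ m i = 1) -> m = M.
  move=> /mnm_lepP mM m0 /chi_dvd dvd.
  have lel l : (m (lift ord_max l) <= n l - 1)%N by rewrite -M_lift.
  have : (m ord_max <= 1)%N by rewrite -M_max.
  case em: (m ord_max) => [|[|//]] _.
    case/eqP: m0; apply/mnmP => i; rewrite mnm0E.
    case: (unliftP ord_max i) => [l ->|-> //].
    have := dvd l; rewrite em addn0; case: (posnP (m (lift ord_max l))) => // mp.
    by move/(dvdn_leq mp); have := lel l; have := n_gt0 l; lia.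
  apply/mnmP => i; case: (unliftP ord_max i) => [l ->|->]; last by rewrite em M_max.
  rewrite M_lift; have := dvd l; rewrite em => /(dvdn_leq (_ : 0 < _)%N).
  by rewrite addn1 => /(_ isT); have := lel l; have := n_gt0 l; lia.
rewrite (eq_bigr (fun l => n l - 1)%N) => [|l _]; last by rewrite nE.
rewrite ltnNge; apply/negP => leM.
have M0 : M != 0%MM by apply/eqP => /mnmP/(_ ord_max); rewrite M_max mnm0E.
have Pchi g : g \in G -> 1%:M *m MxRepresentation repr g = diag_mx (chi g) *m 1%:M.
  by rewrite mul1mx mulmx1.
have lin1 h : h \mPo linforms 1%:M = h :> {mpoly F[r.+1]}.
  by apply: evalv_inj => v; rewrite evalv_comp_linforms mul1mx.
(* The only possible such monomial is [M], whose degree exceeds [e]. So [S] generates nothing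
   containing [M]. *)
have SZ f (m : 'X_{1..r.+1}) : S f -> (m <= M)%MM -> m != 0%MM -> f@_m = 0.
  move=> Sf mM m0; have [finv [j je fj]] := Shom f Sf.
  have [f' ef f'm] := invariant_decomposition (unitmx1 _ _) Pchi finv.
  rewrite lin1 in ef; rewrite -ef in f'm => {f' ef}.
  apply/eqP; rewrite mcoeff_eq0; apply/negP => mf.
  have em := dvd_M _ mM m0 (f'm _ mf).
  move/dhomogP: fj => /(_ m mf); rewrite /= em mdegM => ej.
  by move: (leq_trans je leM); rewrite -ej ltnn.
have Minv : Defs.invariant (MxRepresentation repr) 'X_[M].
  rewrite -(lin1 'X_[M]); apply: monomial_invariant Pchi _ _ => g gG.
  have -> : \prod_i chi g 0 i ^+ M i = \prod_l \prod_i w l ^+ (c i l * M i * E g l).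
    rewrite exchange_big; apply: eq_bigr => i _; rewrite mxE -prodrXl.
    by apply: eq_bigr => l _; rewrite -exprM mulnAC.
  rewrite big1 // => l _; rewrite prodrXr -big_distrl /= sum_c M_lift M_max subnK //.
  by rewrite exprM (prim_expr_order (wp l)) expr1n.
have [d [t [Q [St eM]]]] := gen _ Minv.
have := @mcoeff_comp_eq0 _ _ _ M t Q (fun i m => SZ _ m (St i)) M (lepm_refl _) M0.
by rewrite -eM mcoeffX eqxx => /eqP; rewrite oner_eq0.
Qed.

(** * Comparison of the two bounds *)

Lemma least_positive_exists (Pr : nat -> Prop) e : (0 < e)%N -> Pr e ->
  exists d, least_positive Pr d.
Proof.
move=> e0 Pe; have [|d [d0 Pd] dmin] := @exists_least (fun n => (0 < n)%N /\ Pr n).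
  by exists e.
by exists d; split=> // e' e'0 Pe'; apply: dmin.
Qed.

Lemma sup_modules_exists (F : fieldType) (gT : finGroupType) (G : {group gT})
    (B : forall n : nat, mx_representation F G n -> nat -> Prop) (c : nat) :
  (forall n (rG : mx_representation F G n), exists d, B n rG d) ->
  (forall n (rG : mx_representation F G n) d, B n rG d -> (d <= c)%N) ->
  exists2 b, is_sup_modules B b & (b <= c)%N.
Proof.
move=> Bex Bc; pose ub c' := forall n (rG : mx_representation F G n) d, B n rG d -> (d <= c')%N.
have [|b ubb bmin] := @exists_least ub; first by exists c.
exists b; last exact: bmin.
split=> [n rG|c' /bmin//]; have [d Bd] := Bex n rG; exists d => //; exact: ubb Bd.
Qed.

Lemma cyclic_decomposition_size (gT : finGroupType) (G : {group gT}) (b : seq gT) :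
  ~~ cyclic G -> (\big[dprod/1]_(x <- b) <[x]>)%g = G :> {set gT} -> (1 < size b)%N.
Proof.
move=> ncG; case: b => [|x [|//]].
  by rewrite big_nil => e; rewrite -e cyclic1 in ncG.
by rewrite big_seq1 => e; rewrite -e cycle_cyclic in ncG.
Qed.

(** Put t = n_s. The r - s - 1 terms after it contribute at least 1 each. After cancellation the
    second inequality follows from t <= 2 t - 3 if r = 2 s and from 0 <= 2 t - 5 if r = 2 s - 1;
    both hold as t >= 3. *)
Lemma reflection_bound (r s : nat) (n : nat -> nat) :
  (forall l, (l < r)%N -> (1 < n l)%N) -> (forall l, (l < s)%N -> (n s <= n l)%N) ->
  (0 < s < r)%N -> (2 < n s)%N -> r.+1 = (2 * s)%N \/ r = (2 * s)%N ->
  (\sum_(l < s) n l <= \sum_(l < r) (n l - 1))%N /\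
  (r.+1 * n s + 2 * \sum_(l < s) (n l - n s) <= (2 * \sum_(l < r) (n l - 1)).+1)%N.
Proof.
move=> n1 ns /andP[s0 sr] ns2 def_s.
have -> : (\sum_(l < r) (n l - 1) =
    \sum_(l < s) (n l - 1) + (n s - 1) + \sum_(s.+1 <= l < r) (n l - 1))%N.
  rewrite -!(big_mkord xpredT (fun l => n l - 1)%N).
  by rewrite (big_cat_nat (n := s)) //= 1?ltnW // [X in (_ + X)%N]big_ltn // addnA.
have tail : (r - s.+1 <= \sum_(s.+1 <= l < r) (n l - 1))%N.
  rewrite -[X in (X <= _)%N]muln1 -sum_nat_const_nat big_nat [X in (_ <= X)%N]big_nat.
  by apply: leq_sum => l /andP[_ lr]; have := n1 l lr; lia.
have sum_sub t : (t <= n s)%N -> (\sum_(l < s) (n l - t) + s * t = \sum_(l < s) n l)%N.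
  move=> ts; rewrite -[X in (_ + X * t)%N]card_ord -sum_nat_const -big_split /=.
  by apply: eq_bigr => l _; rewrite subnK // (leq_trans ts) // ns.
have := sum_sub _ (leqnn _); have := sum_sub 1%N (ltnW (ltnW ns2)).
move: (\sum_(l < s) n l)%N (\sum_(l < s) (n l - 1))%N (\sum_(l < s) (n l - n s))%N tail.
move: (\sum_(s.+1 <= l < r) (n l - 1))%N (n s) ns2 => T t t3 A B C rT eB eC.
case: def_s => er; first by (split; [lia | rewrite er; nia]).
by split; [lia | rewrite er; nia].
Qed.

(* ns = [:: n_1; ...; n_r] is indexed from 0, so n_(s+1) is nth 0 ns s. *)
Theorem corollary3p11 (F : closedFieldType) (gT : finGroupType)
    (G : {group gT}) (ns : seq nat) (s : nat)
    (abG : abelian G) (ncG : ~~ cyclic G)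
    (charF : forall p : nat, p \in [pchar F] -> ~~ (p %| #|G|)%N)
    (decG : cyclic_decomposition G ns)
    (dvd_ns : sorted (fun m k : nat => (k %| m)%N) ns)
    (last_ns : (1 < last 0%N ns)%N)
    (def_s : (size ns).+1 = (2 * s)%N \/ size ns = (2 * s)%N)
    (ns_neq2 : nth 0%N ns s <> 2%N) :
  exists bsep b : nat,
    [/\ is_group_beta_sep F G bsep, is_group_beta F G b & (bsep < b)%N].
Proof.
case: decG => b defG eb.
have r1 := cyclic_decomposition_size ncG defG.
have sz : size ns = size b by rewrite -eb size_map.
rewrite sz in def_s; set r := size b in r1 def_s sz *.
(* The default 1 supplies n_r = 1, the bottom level of the filtration. *)
pose n := nth 1%N ns.
have cG : #|G|%:R != 0 :> F.
  apply/negP => c0; have [p pF] := natf0_pchar (cardG_gt0 G) c0.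
  by have := charF p pF; rewrite (dvdn_pcharf pF) c0.
have dvd_n i j : (i <= j <= r)%N -> (n j %| n i)%N.
  case/andP=> ij; rewrite leq_eqVlt => /orP[/eqP->|jr].
    by rewrite /n nth_default ?sz // dvd1n.
  apply: (@sorted_leq_nth _ (fun m k : nat => (k %| m)%N)) => //.
  - by move=> x y z xy yz; apply: dvdn_trans yz xy.
  - by rewrite inE sz (leq_ltn_trans ij).
  - by rewrite inE sz.
have n_gt1 l : (l < r)%N -> (1 < n l)%N.
  move=> lr; apply: (@leq_trans (n r.-1)).
    by rewrite /n -sz (set_nth_default 0%N) ?nth_last // sz; case: (r) r1.
  apply: dvdn_leq; last by apply: dvd_n; lia.
  by rewrite /n -eb (nth_map 1%g) // order_gt0.
have nr : n r = 1%N by rewrite /n nth_default // sz.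
(* As [G] is not cyclic, r >= 2, so s < r and n_s is a genuine invariant: it exceeds 1 and differs
   from 2. *)
have s_bounds : (0 < s < r)%N by lia.
have ns3 : (2 < n s)%N.
  have := n_gt1 s; case/andP: s_bounds => _ sr /(_ sr).
  by move: ns_neq2; rewrite (set_nth_default 1%N) ?sz // -/n; lia.
pose N := n 0%N; have N1 : (1 < N)%N by apply: n_gt1; lia.
have n_le l : (l < s)%N -> (n s <= n l)%N.
  move=> ls; apply: dvdn_leq; first by apply: ltnW; apply: n_gt1; lia.
  by apply: dvd_n; lia.
have [led bound] := reflection_bound n_gt1 n_le s_bounds ns3 def_s.
set d := (\sum_(l < r) (n l - 1))%N in led bound.
have d_gt0 : (0 < d)%N.
  apply: leq_trans led; case/andP: s_bounds => s0 _; case: (s) s0 => // s' _.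
  by rewrite big_ord_recl addn_gt0 (ltnW N1).
have [z zN] : exists z : F, N.-primitive_root z.
  apply: closed_prim_root; first exact: ltnW.
  have : (N %| #|G|)%N.
    rewrite /N /n -eb (nth_map 1%g) ?(ltnW r1) //.
    by apply: order_dvdG; apply: (mem_bigdprod_cycle defG); rewrite mem_nth // ltnW.
  by case/dvdnP => q eq; apply: contraNneq cG => N0; rewrite eq natrM N0 mulr0.
have bN x : x \in b -> (#[x]%g %| N)%N.
  move=> xb; rewrite -(nth_index 1%g xb) -(nth_map 1%g 1%N) ?index_mem // eb.
  by apply: dvd_n; rewrite /= ltnW // index_mem.
have data k (rG : mx_representation F G k) :
    separating_set rG (invariants_le rG d) /\
    generating_set rG (invariants_le rG #|{: 'rV['Z_N]_r}|).
  have [P Pu [chi Pchi]] := repr_diagonalizable rG abG cG.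
  have [chi1 chiM] := diag_action_character Pu Pchi.
  have [a [an aP]] := character_exponents defG N1 zN bN chi1 chiM.
  split; last exact: (@generating_invariants_le F gT G k rG P chi Pu Pchi 'rV['Z_N]_r a aP).
  apply: (separating_of_monomials Pu Pchi aP).
  apply: (separating_short (n := n) (s := s)) => //.
  - exact: ltnW.
  - by move=> i l; rewrite /n -eb an.
  - by lia.
  - by lia.
have homS e k (rG : mx_representation F G k) : homog_invariants_le rG e (invariants_le rG e).
  by [].
set D := #|_| in data.
have D_gt0 : (0 < D)%N by apply/card_gt0P; exists 0.
have [||bsep sup_sep lesep] := @sup_modules_exists F gT G (fun k rG => @is_beta_sep F gT G k rG) d.
- move=> k rG; apply: (least_positive_exists d_gt0).
  by exists (invariants_le rG d) => //; case: (data k rG).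
- move=> k rG e [_ _ emin]; apply: emin => //.
  by exists (invariants_le rG d) => //; case: (data k rG).
have [||b' sup_b leb] := @sup_modules_exists F gT G (fun k rG => @is_beta F gT G k rG) D.
- move=> k rG; apply: (least_positive_exists D_gt0).
  by exists (invariants_le rG D) => //; case: (data k rG).
- move=> k rG e [_ _ emin]; apply: emin => //.
  by exists (invariants_le rG D) => //; case: (data k rG).
exists bsep, b'; split=> //.
have [k [rG large]] := large_degree_module abG defG cG.
have [e [_ [S Shom Sgen] _] leb'] := sup_b.1 k rG.
(* The chain is bsep <= d < e <= b', with e the Noether number of the module [rG]. *)
apply: leq_ltn_trans lesep _; apply: leq_trans leb'.
by have := large e S Shom Sgen; rewrite eb.
Qed.
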